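(* Let $Z\sim N_d(\theta,\sigma^2 I_d)$ with $\theta\in\mathbb{R}^d$ unknown and $\sigma^2>0$ known, and let $p>0$. Assume $d\ge 3$ and $0\le\alpha<(d-2)/(d-1)$. Assume $\phi(v)$ is absolutely continuous, monotone non-decreasing and $$0\le\phi(v)\le 2(d-2)\gamma(d,p,\alpha),$$ where $$\gamma(d,p,\alpha)=\min\bigl(1,d^{(2-p-\alpha)/p}\bigr)\left\{1-\alpha\frac{d-1}{d-2}\right\}.$$ Then the shrinkage estimator $\hat\theta_\phi$ with $i$-th component ($i=1,\dots,d$) $$\hat\theta_{i\phi}=\left(1-\frac{\sigma^2\phi(\|z\|_p/\sigma)}{\|z\|_p^{2-\alpha}|z_i|^{\alpha}}\right)z_i$$ is minimax.
   Context: For $p>0$, $\|z\|_p=\{\sum_{i=1}^d|z_i|^p\}^{1/p}$. The function $\phi$ is a real-valued function of $v\ge 0$. The loss of an estimator $\delta$ is $L(\delta,\theta)=\sum_{i=1}^d(\delta_i-\theta_i)^2/\sigma^2$ and its risk is $E[L(\delta(Z),\theta)]$. An estimator is minimax if it minimizes $\sup_\theta E[L(\delta(Z),\theta)]$ among all estimators. The estimator $z$ is minimax with constant risk $d$, so $\delta$ is minimax if and only if its risk is at most $d$ for every $\theta$. The estimator is defined for $z$ with all coordinates nonzero, which holds almost surely. *)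

(* Defs.v *)
From HB Require Import structures.
From mathcomp Require Import all_boot all_order all_algebra.
From mathcomp Require Import all_classical all_reals all_analysis.
Import Order.TTheory GRing.Theory Num.Theory.
Import numFieldNormedType.Exports.

Set Implicit Arguments.
Unset Strict Implicit.
Unset Printing Implicit Defensive.

Local Open Scope classical_set_scope.
Local Open Scope ring_scope.

Section normal_vector.
Context {R : realType}.

(* measurableTypeR R is R with its Borel sets, as used by normal_prob. *)
Definition tuple_cons n (x : measurableTypeR R * n.-tuple R) :
    n.+1.-tuple R := [tuple of (x.1 : R) :: x.2].

Lemma measurable_tuple_cons n :
  measurable_fun [set: measurableTypeR R * n.-tuple R] (@tuple_cons n).
Proof.
apply: (@measurable_cons _ _ _ R (fun x => x.1)) => //.
exact: measurable_fst.
Qed.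

HB.instance Definition _ n :=
  isMeasurableFun.Build _ _ _ _ (@tuple_cons n) (@measurable_tuple_cons n).

(* N_n(theta, s^2 I_n): the product of the N(theta_i, s^2), built one
   coordinate at a time; see normal_vector_rectangle.  As for normal_prob,
   s is the standard deviation. *)
Fixpoint normal_vector n (s : R) :
    n.-tuple R -> probability (n.-tuple R) R :=
  match n with
  | 0 => fun=> \d_([tuple] : 0.-tuple R)
  | n'.+1 => fun theta =>
      distribution
        (normal_prob (thead theta) s \x
         normal_vector s ([tuple of behead theta] : n'.-tuple R))%E
        (@tuple_cons n')
  end.

Lemma measurable_rectangle n (A : 'I_n -> set R) :
  (forall i, measurable (A i)) ->
  measurable [set z : n.-tuple R | forall i, A i (tnth z i)].
Proof.
move=> mA.
rewrite (_ : [set z | _] =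
  \bigcap_(i in [set: 'I_n]) ((fun z : n.-tuple R => tnth z i) @^-1` A i)).
  apply: fin_bigcap_measurable => // i _.
  by rewrite -[X in measurable X]setTI; exact: (measurable_tnth i).
by apply/seteqP; split=> z /= h i; [move=> _|]; exact: h.
Qed.

Lemma normal_vector_rectangle n (s : R) (theta : n.-tuple R)
    (A : 'I_n -> set R) : (forall i, measurable (A i)) ->
  normal_vector s theta [set z | forall i, A i (tnth z i)] =
  (\prod_(i < n) normal_prob (tnth theta i) s (A i))%E.
Proof.
elim: n theta A => [|n IHn] theta A mA.
  rewrite big_ord0 /= (_ : [set z | _] = setT) ?diracT//.
  by apply/seteqP; split=> // z _ [].
rewrite big_ord_recl /= /distribution /pushforward.
have mB : forall i, measurable (A (lift ord0 i)) by move=> i; exact: mA.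
rewrite (_ : _ @^-1` _ = (A ord0 : set (measurableTypeR R)) `*`
    [set z : n.-tuple R | forall i, A (lift ord0 i) (tnth z i)]); last first.
  apply/seteqP; split=> [[x z] /= h|[x z] /= [h0 h] i].
    split; first exact: (h ord0).
    by move=> i; have := h (lift ord0 i); rewrite tnthS.
  by case: (unliftP ord0 i) => [j ->|->]; [rewrite tnthS; apply: (h j)|].
rewrite [LHS](@product_measure1E _ _ (measurableTypeR R) _ R); last 2 first.
- exact: mA.
- exact: (@measurable_rectangle n (fun i => A (lift ord0 i))).
have IH := @IHn [tuple of behead theta] (fun i => A (lift ord0 i)) mB.
congr (_ * _)%E.
rewrite [LHS]IH; apply: eq_bigr => i _; rewrite tnth_behead.
rewrite (_ : inord i.+1 = lift ord0 i)//.
by apply/val_inj; rewrite /= inordK // ltnS.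
Qed.

End normal_vector.

Section estimation.
Context {R : realType}.

(* Parameters, observations and estimates in R^d are d-tuples.  An estimator
   is a map delta with measurable components; delta(Z) is studied on the
   canonical space, Z being the identity under normal_vector. *)

Definition loss d (s : R) (a theta : d.-tuple R) : R :=
  \sum_(i < d) (tnth a i - tnth theta i) ^+ 2 / s ^+ 2.

Definition risk d (s : R) (delta : d.-tuple R -> d.-tuple R)
    (theta : d.-tuple R) : \bar R :=
  'E_(normal_vector s theta)[fun z => loss s (delta z) theta]%E.

Definition sup_risk d (s : R) (delta : d.-tuple R -> d.-tuple R) : \bar R :=
  ereal_sup [set risk s delta theta | theta in [set: d.-tuple R]].

Definition minimax d (s : R) (delta : d.-tuple R -> d.-tuple R) : Prop :=
  measurable_fun [set: d.-tuple R] delta /\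
  forall delta' : d.-tuple R -> d.-tuple R,
    measurable_fun [set: d.-tuple R] delta' ->
    (sup_risk s delta <= sup_risk s delta')%E.

Definition pnorm d (p : R) (z : d.-tuple R) : R :=
  (\sum_(i < d) `|tnth z i| `^ p) `^ p^-1.

Definition gamma d (p alpha : R) : R :=
  Num.min 1 (d%:R `^ ((2 - p - alpha) / p)) *
  (1 - alpha * ((d%:R - 1) / (d%:R - 2))).

(* Where some coordinate of z vanishes (a null set) the value follows the
   conventions 0^-1 = 0 and 0 `^ 0 = 1. *)
Definition shrinkage d (s p alpha : R) (phi : R -> R) (z : d.-tuple R) :
    d.-tuple R :=
  [tuple (1 - s ^+ 2 * phi (pnorm p z / s) /
              (pnorm p z `^ (2 - alpha) * `|tnth z i| `^ alpha)) * tnth z i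
   | i < d].

(* D is meant to be an interval: it then contains each [a i, b i]. *)
Definition abs_continuous_on (D : set R) (f : R -> R) : Prop :=
  forall e : R, 0 < e -> exists2 r : R, 0 < r &
    forall (n : nat) (a b : 'I_n -> R),
      (forall i, D (a i) /\ D (b i) /\ a i <= b i) ->
      trivIset setT (fun i => `]a i, b i[%classic) ->
      \sum_(i < n) (b i - a i) < r ->
      \sum_(i < n) `|f (b i) - f (a i)| < e.

End estimation.

(* Main.v *)
From HB Require Import structures.
Require Import Defs.
From mathcomp Require Import all_boot all_order all_algebra.
From mathcomp Require Import all_classical all_reals all_analysis.
From mathcomp Require Import measurable_realfun.
From mathcomp Require Import ring lra.
Import Order.TTheory GRing.Theory Num.Theory.
Import numFieldNormedType.Exports.

(** The estimator Z itself has risk d at every theta, so two things have to be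
shown: no estimator has a supremum of risk below d, and the shrinkage estimator
has risk at most d everywhere.

Lower bound (sup_risk_ge). The supremum of the risk dominates the Bayes risk for
the prior N(0, t^2 I). In each coordinate, given everything else, the expected
loss of any estimator is at least the posterior variance divided by s^2, that is
t^2 / (s^2 + t^2), which tends to 1 when t grows.

Upper bound (risk_shrinkage_le). Write the estimator as z - s^2 Phi(z) h(z) with
Phi(z) = phi(|z|_p / s) and h_i(z) = z_i / (|z|_p^(2 - alpha) |z_i|^alpha).
Integration by parts in coordinate i turns the expectation of
Phi (z_i - theta_i) h_i into s^2 times that of Phi d_i h_i + h_i d_i Phi. As Phi
is nondecreasing in |z_i| and h_i has the sign of z_i, the second term is
nonnegative, and the expectation of Phi (z_i - theta_i) h_i is at least s^2 times
that of Phi d_i h_i (stein_inequality). The proof works with symmetric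
differences, which translation moves from h to Phi, where monotonicity decides
their sign. The risk is then at most d as soon as
Phi |h|^2 <= 2 div h pointwise. This is mul_sqr_norm_le_divergence, a consequence
of the sum inequality of Chebyshev, which compares the sums of powers of |z_i| in
div h and in |h|^2, and of the comparison of power sums, which produces the
minimum in gamma.

The field h is singular where coordinates vanish. The argument is therefore
carried out with z_i^2 + e in place of z_i^2 in h, which makes h smooth with
bounded partial derivatives and keeps the pointwise inequality; the lemma of
Fatou lets e tend to 0.

One-dimensional facts are lifted to the product measure by ge0_le_integral_coord:
inequalities between integrals in one coordinate, valid for all values of the
others, integrate to inequalities between full integrals. *)

Set Implicit Arguments.
Unset Strict Implicit.
Unset Printing Implicit Defensive.

Local Open Scope classical_set_scope.
Local Open Scope ring_scope.

(** * Gaussian integrals on the line *)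

Section normal_measure.
Context {R : realType}.
Notation mu := (@lebesgue_measure R).
Implicit Types (m s t : R) (f : R -> R).

(** The density defines normal_prob on sets only; the passage to functions is the
change of variables for the Radon-Nikodym derivative, which agrees with the
density almost everywhere. *)
Lemma ge0_integral_normal_prob m s (f : R -> \bar R) :
  measurable_fun setT f -> (forall x, 0 <= f x)%E ->
  (\int[normal_prob m s]_x f x = \int[mu]_x (f x * (normal_pdf m s x)%:E))%E.
Proof.
move=> mf f0.
have dom := normal_prob_dominates m s.
rewrite -(Radon_Nikodym_SigmaFinite.change_of_variables dom)//.
have rnint := Radon_Nikodym_SigmaFinite.f_integrable dom.
apply: ae_eq_integral => //.
- by apply: emeasurable_funM => //; exact: measurable_int rnint.
- apply: emeasurable_funM => //; apply/measurable_EFinP.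
  exact: measurable_normal_pdf.
have : ae_eq mu setT (Radon_Nikodym_SigmaFinite.f (normal_prob m s) mu)
    (fun x => (normal_pdf m s x)%:E).
  apply: integral_ae_eq => //.
    by apply/measurable_EFinP; exact: measurable_normal_pdf.
  by move=> A _ mA; rewrite -(Radon_Nikodym_SigmaFinite.f_integral dom).
by apply: filterS => x /= h _; rewrite h.
Qed.

(** It holds without integrability: the integral of a signed function is by
definition a difference of two integrals of nonnegative functions, and
multiplication by the density respects that decomposition. *)
Lemma integral_normal_prob m s f : measurable_fun setT f ->
  (\int[normal_prob m s]_x (f x)%:E =
   \int[mu]_x (f x * normal_pdf m s x)%:E)%E.
Proof.
move=> mf; rewrite integralE [RHS]integralE; congr (_ - _)%E.
- rewrite ge0_integral_normal_prob//; last first.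
    by apply: measurable_funepos; exact/measurable_EFinP.
  apply: eq_integral => x _; rewrite !funeposE -!EFin_max -EFinM.
  by rewrite maxr_pMl ?normal_pdf_ge0// mul0r.
- rewrite ge0_integral_normal_prob//; last first.
    by apply: measurable_funeneg; exact/measurable_EFinP.
  apply: eq_integral => x _; rewrite !funenegE -!EFinN -!EFin_max -EFinM.
  by rewrite maxr_pMl ?normal_pdf_ge0// mul0r mulNr.
Qed.

(** The typing makes the pushforward of Lebesgue measure along this map a measure
on the Borel sets. *)
Definition translation t : measurableTypeR R -> measurableTypeR R :=
  fun x => x + t.

Lemma measurable_translation t : measurable_fun setT (translation t).
Proof. exact: measurable_funD. Qed.

HB.instance Definition _ t := isMeasurableFun.Build _ _ _ _
  (translation t) (measurable_translation t).

Lemma lebesgue_measure_translation t (A : set R) : measurable A ->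
  pushforward mu (translation t) A = mu A.
Proof.
move=> mA; apply/esym/lebesgue_measure_unique => //= _ [[a b]] _ <-.
rewrite /pushforward (_ : _ @^-1` _ = `]a - t, b - t]%classic); last first.
  by apply/seteqP; split => x /=; rewrite !in_itv/= ltrBlDr lerBrDr.
rewrite !lebesgue_measure_itv/= !lte_fin ltrD2r.
by case: ifPn => // _; congr (_%:E); lra.
Qed.

Lemma ge0_integral_translation t (f : R -> \bar R) :
  measurable_fun setT f -> (forall x, 0 <= f x)%E ->
  (\int[mu]_x f x = \int[mu]_x f (x + t)%R)%E.
Proof.
move=> mf f0.
rewrite (eq_measure_integral (pushforward mu (translation t))); last first.
  by move=> A mA _; apply/esym; exact: lebesgue_measure_translation.
by rewrite (ge0_integral_pushforward (measurable_translation t))//= preimage_setT.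
Qed.

Lemma integral_translation t f : measurable_fun setT f ->
  (\int[mu]_x (f x)%:E = \int[mu]_x (f (x + t)%R)%:E)%E.
Proof.
move=> mf; rewrite integralE [RHS]integralE; congr (_ - _)%E.
- rewrite (@ge0_integral_translation t)//; last first.
    by apply: measurable_funepos; exact/measurable_EFinP.
  by apply: eq_integral => x _; rewrite !funeposE.
- rewrite (@ge0_integral_translation t)//; last first.
    by apply: measurable_funeneg; exact/measurable_EFinP.
  by apply: eq_integral => x _; rewrite !funenegE.
Qed.

Lemma normal_pdf_translation m s x : s != 0 ->
  normal_pdf m s (x + m) = normal_pdf 0 s x.
Proof.
by move=> s0; rewrite !normal_pdfE//= /normal_fun addrK subr0.
Qed.

(** This moves the mean from the measure into the integrand, where it becomes a
variable to which the theorem of Tonelli applies. *)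
Lemma ge0_integral_normal_prob_shift m s (f : R -> \bar R) : s != 0 ->
  measurable_fun setT f -> (forall x, 0 <= f x)%E ->
  (\int[normal_prob m s]_x f x = \int[normal_prob 0 s]_x f (x + m)%R)%E.
Proof.
move=> s0 mf f0.
have mpdf : measurable_fun setT (fun x : R => (normal_pdf m s x)%:E).
  by apply/measurable_EFinP; exact: measurable_normal_pdf.
rewrite [LHS](ge0_integral_normal_prob m s mf f0).
have mfm : measurable_fun setT (fun x : R => f (x + m)%R).
  by apply: measurableT_comp => //; exact: measurable_funD.
rewrite [RHS](ge0_integral_normal_prob 0 s mfm (fun x => f0 _)).
have g0 x : (0 <= f x * (normal_pdf m s x)%:E)%E.
  by rewrite mule_ge0// lee_fin normal_pdf_ge0.
rewrite [LHS](ge0_integral_translation m (emeasurable_funM mf mpdf) g0).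
by apply: eq_integral => x _; rewrite normal_pdf_translation.
Qed.

End normal_measure.

(** * Product Gaussian measures, one coordinate at a time *)

Section coordinates.
Context {R : realType}.
Implicit Types (s x : R).

Definition set_coord n (z : n.-tuple R) (i : 'I_n) x : n.-tuple R :=
  [tuple if j == i then x else tnth z j | j < n].

Lemma tnth_set_coord n (z : n.-tuple R) i x j :
  tnth (set_coord z i x) j = if j == i then x else tnth z j.
Proof. by rewrite tnth_mktuple. Qed.

Lemma set_coord_set n (z : n.-tuple R) i x y : set_coord (set_coord z i x) i y = set_coord z i y.
Proof.
by apply/eq_from_tnth => j; rewrite !tnth_set_coord; case: (j == i).
Qed.

Lemma measurable_set_coord d (T : measurableType d) n (f : T -> n.-tuple R) i
    (g : T -> R) : measurable_fun setT f -> measurable_fun setT g ->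
  measurable_fun setT (fun t => set_coord (f t) i (g t)).
Proof.
move=> mf mg; apply/measurable_fun_tnthP => j.
rewrite (_ : _ \o _ = fun t => if j == i then g t else tnth (f t) j).
  by case: (j == i) => //; move/measurable_fun_tnthP : mf; exact.
by apply/funext => t /=; rewrite tnth_set_coord.
Qed.

Lemma set_coord_cons0 n x (z : n.-tuple R) y :
  set_coord [tuple of x :: z] ord0 y = [tuple of y :: z].
Proof.
apply/eq_from_tnth => j; rewrite tnth_set_coord.
by case: (unliftP ord0 j) => [k ->|->]; rewrite ?tnthS.
Qed.

Lemma set_coord_consS n x (z : n.-tuple R) i y :
  set_coord [tuple of x :: z] (lift ord0 i) y = [tuple of x :: set_coord z i y].
Proof.
apply/eq_from_tnth => j; rewrite tnth_set_coord.
case: (unliftP ord0 j) => [k ->|->]; rewrite ?tnthS ?tnth_set_coord//=.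
Qed.

Section first_coordinate.
Variables (n : nat) (s : R) (theta : n.+1.-tuple R).
Variable U : n.+1.-tuple R -> \bar R.
Hypotheses (mU : measurable_fun setT U) (U0 : forall z, (0 <= U z)%E).
Let P := normal_prob (thead theta) s.
Let Q := normal_vector s ([tuple of behead theta] : n.-tuple R).

Let mU' : measurable_fun setT (U \o @tuple_cons R n).
Proof. exact: measurableT_comp (@measurable_tuple_cons R n). Qed.

Let integral_prod : (\int[normal_vector s theta]_z U z =
   \int[P \x Q]_y (U \o @tuple_cons R n) y)%E.
Proof.
by rewrite [LHS](ge0_integral_pushforward (@measurable_tuple_cons R n))
  ?preimage_setT.
Qed.

(** normal_vector is built by adding coordinate 0 in front. Integrating that
coordinate last leaves the other coordinates for an induction; integrating it
first (normal_vector_tonelli2) isolates it. *)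
Lemma normal_vector_tonelli1 : (\int[normal_vector s theta]_z U z =
  \int[P]_x \int[Q]_z U [tuple of x :: z])%E.
Proof.
by rewrite integral_prod (fubini_tonelli1 _ mU')// => x; exact: U0.
Qed.

Lemma normal_vector_tonelli2 : (\int[normal_vector s theta]_z U z =
  \int[Q]_z \int[P]_x U [tuple of x :: z])%E.
Proof.
by rewrite integral_prod (fubini_tonelli2 _ mU')// => x; exact: U0.
Qed.

Lemma measurable_normal_vector_tonelli1 : measurable_fun setT
  (fun x : measurableTypeR R => \int[Q]_z U [tuple of x :: z])%E.
Proof. by apply: measurable_fun_fubini_tonelli_F mU' _ => x; exact: U0. Qed.

Lemma measurable_normal_vector_tonelli2 : measurable_fun setT
  (fun z : n.-tuple R => \int[P]_x U [tuple of x :: z])%E.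
Proof. by apply: measurable_fun_fubini_tonelli_G mU' _ => x; exact: U0. Qed.

End first_coordinate.

(** The passage from one to n dimensions: an inequality that holds between the
integrals in coordinate i, whatever the frozen values of the other
coordinates, holds between the full integrals. Nonnegativity replaces
integrability, which would be lost when coordinates are frozen. *)
Lemma ge0_le_integral_coord n s (theta : n.-tuple R) i
    (U V : n.-tuple R -> \bar R) :
  measurable_fun setT U -> measurable_fun setT V ->
  (forall z, 0 <= U z)%E -> (forall z, 0 <= V z)%E ->
  (forall z, \int[normal_prob (tnth theta i) s]_x U (set_coord z i x) <=
             \int[normal_prob (tnth theta i) s]_x V (set_coord z i x))%E ->
  (\int[normal_vector s theta]_z U z <= \int[normal_vector s theta]_z V z)%E.
Proof.
elim: n theta i U V => [theta []//|n IH] theta i U V mU mV U0 V0 UV.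
case: (unliftP ord0 i) => [k|] ik.
- rewrite !normal_vector_tonelli1//; apply: ge0_le_integral => //.
  + by move=> x _; apply: integral_ge0 => z _; exact: U0.
  + exact: measurable_normal_vector_tonelli1.
  + exact: measurable_normal_vector_tonelli1.
  + move=> x _; apply: (IH _ k) => //.
    * by apply: measurableT_comp => //; exact: measurable_cons.
    * by apply: measurableT_comp => //; exact: measurable_cons.
    move=> z.
    have ti : tnth theta i = tnth [tuple of behead theta] k.
      rewrite ik tnth_behead; congr tnth.
      by apply/val_inj; rewrite /= inordK // ltnS.
    have E (W : n.+1.-tuple R -> \bar R) :
        (\int[normal_prob (tnth theta i) s]_y W (set_coord [tuple of x :: z] i y) =
         \int[normal_prob (tnth [tuple of behead theta] k) s]_y
           W [tuple of x :: set_coord z k y])%E.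
      by rewrite -ti; apply: eq_integral => y _; rewrite ik set_coord_consS.
    by have := UV [tuple of x :: z]; rewrite (E U) (E V).
- rewrite !normal_vector_tonelli2//; apply: ge0_le_integral => //.
  + by move=> x _; apply: integral_ge0 => z _; exact: U0.
  + exact: measurable_normal_vector_tonelli2.
  + exact: measurable_normal_vector_tonelli2.
  + move=> z _.
    have E (W : n.+1.-tuple R -> \bar R) :
        (\int[normal_prob (tnth theta i) s]_y W (set_coord [tuple of 0%R :: z] i y) =
         \int[normal_prob (thead theta) s]_y W [tuple of y :: z])%E.
      by rewrite ik; apply: eq_integral => y _; rewrite set_coord_cons0.
    by have := UV [tuple of 0%R :: z]; rewrite (E U) (E V).
Qed.

End coordinates.

Section more_coordinates.
Context {R : realType}.
Implicit Types (s x : R).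

(** The signed version compares the positive part of f with its negative part
plus c. The bound B, uniform in the frozen coordinates, makes f integrable. *)
Lemma integral_le_coord n s (theta : n.-tuple R) i (f : n.-tuple R -> R)
    (B c : R) :
  measurable_fun setT f -> 0 <= c ->
  (forall z, \int[normal_prob (tnth theta i) s]_x `|f (set_coord z i x)|%:E <= B%:E)%E ->
  (forall z, \int[normal_prob (tnth theta i) s]_x (f (set_coord z i x))%:E <= c%:E)%E ->
  (normal_vector s theta).-integrable setT (EFin \o f) /\
  (\int[normal_vector s theta]_z (f z)%:E <= c%:E)%E.
Proof.
move=> mf c0 fB fc.
set N := normal_prob (tnth theta i) s.
set P := normal_vector s theta.
have mEf : measurable_fun setT (EFin \o f) by exact/measurable_EFinP.
have mfu z : measurable_fun setT (fun x => f (set_coord z i x)).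
  by apply: measurableT_comp => //; exact: measurable_set_coord.
have cstN (a : R) : (\int[N]_x a%:E = a%:E)%E.
  by rewrite integral_cst//= [X in (_ * X)%E]probability_setT mule1.
have cstP (a : R) : (\int[P]_x a%:E = a%:E)%E.
  by rewrite integral_cst//= [X in (_ * X)%E]probability_setT mule1.
have B0 : 0 <= B.
  have := fB [tuple 0 | j < n]; rewrite -lee_fin; apply: le_trans.
  by apply: integral_ge0 => x _; rewrite lee_fin.
have absf : (\int[P]_z `|f z|%:E <= B%:E)%E.
  rewrite -[leRHS]cstP; apply: (ge0_le_integral_coord (i := i)) => //.
  - by apply/measurable_EFinP; exact: measurableT_comp.
  - by move=> z; rewrite cstN; exact: fB.
have intf : P.-integrable setT (EFin \o f).
  apply/integrableP; split => //.
  by apply: le_lt_trans absf _; rewrite ltry.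
split => //.
have intN z : N.-integrable setT (EFin \o (fun x => f (set_coord z i x))).
  apply/integrableP; split; first by apply/measurable_EFinP; exact: mfu.
  by apply: le_lt_trans (fB z) _; rewrite ltry.
have key (a b : \bar R) : b \is a fin_num ->
    (a <= b + c%:E -> a - b <= c%:E)%E.
  by move=> bfin; rewrite leeBlDl.
have cmp : (\int[P]_z (EFin \o f)^\+ z <=
            \int[P]_z ((EFin \o f)^\- z + c%:E))%E.
  apply: (ge0_le_integral_coord (i := i)) => //.
  - exact: measurable_funepos.
  - by apply: emeasurable_funD => //; exact: measurable_funeneg.
  - by move=> z; rewrite adde_ge0.
  move=> z; rewrite ge0_integralD//; last first.
    apply: (measurableT_comp (measurable_funeneg mEf)).
    exact: measurable_set_coord.
  rewrite cstN -leeBlDl//; last first.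
    have := integrable_neg_fin_num measurableT (intN z).
    by rewrite (_ : _ \o _ = (EFin \o f) \o set_coord z i)// funeneg_comp.
  have := integralE N setT ((EFin \o f) \o set_coord z i).
  by rewrite funepos_comp funeneg_comp => <-; exact: fc.
rewrite (integralE P setT (EFin \o f)).
have fin := integrable_neg_fin_num measurableT intf.
move: cmp; rewrite ge0_integralD//; last exact: measurable_funeneg.
by rewrite cstP; exact: key.
Qed.

Definition tuple_add n (z theta : n.-tuple R) : n.-tuple R :=
  [tuple tnth z j + tnth theta j | j < n].

Definition tuple_zero n : n.-tuple R := [tuple 0 | j < n].

Lemma measurable_tuple_add d (T : measurableType d) n (f g : T -> n.-tuple R) :
  measurable_fun setT f -> measurable_fun setT g ->
  measurable_fun setT (fun t => tuple_add (f t) (g t)).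
Proof.
move=> /measurable_fun_tnthP mf /measurable_fun_tnthP mg.
apply/measurable_fun_tnthP => j.
rewrite (_ : _ \o _ = (fun t => tnth (f t) j + tnth (g t) j)).
  by apply: measurable_funD; [exact: mf|exact: mg].
by apply/funext => t /=; rewrite tnth_mktuple.
Qed.

(** It turns the risk at theta into an integral against noise that does not
depend on theta, hence into a measurable function of theta that can be
averaged over a prior. *)
Lemma ge0_integral_normal_vector_shift n s (theta : n.-tuple R)
    (U : n.-tuple R -> \bar R) : s != 0 ->
  measurable_fun setT U -> (forall z, 0 <= U z)%E ->
  (\int[normal_vector s theta]_z U z =
   \int[normal_vector s (tuple_zero n)]_z U (tuple_add z theta))%E.
Proof.
move=> s0.
elim: n theta U => [theta|n IH theta] U mU U0.
  rewrite (tuple0 theta) (tuple0 (tuple_zero 0)); apply: eq_integral => z _.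
  by rewrite (tuple0 z) (tuple0 (tuple_add _ _)).
have th0 : [tuple of behead (tuple_zero n.+1)] = tuple_zero n :> n.-tuple R.
  by apply/eq_from_tnth => j; rewrite tnth_behead !tnth_mktuple.
rewrite [LHS](normal_vector_tonelli1 s theta mU U0).
rewrite (@ge0_integral_normal_prob_shift _ (thead theta) s
  (fun x => \int[normal_vector s ([tuple of behead theta] : n.-tuple R)]_z
     U [tuple of x :: z]))%E//; first last.
- by move=> x; apply: integral_ge0 => z _; exact: U0.
- exact: measurable_normal_vector_tonelli1.
have mUt : measurable_fun setT (fun z => U (tuple_add z theta)).
  by apply: measurableT_comp => //; exact: measurable_tuple_add.
rewrite [RHS](normal_vector_tonelli1 s (tuple_zero n.+1) mUt (fun z => U0 _)).
have h0 : thead (tuple_zero n.+1) = 0 by rewrite /thead tnth_mktuple.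
rewrite h0 th0; apply: eq_integral => x _.
have mUc : measurable_fun setT
    (fun z : n.-tuple R => U [tuple of (x + thead theta)%R :: z]).
  by apply: measurableT_comp => //; exact: measurable_cons.
rewrite [LHS](IH _ _ mUc (fun z => U0 _)).
apply: eq_integral => z _; congr U; apply/eq_from_tnth => j.
rewrite tnth_mktuple; case: (unliftP ord0 j) => [k ->|->].
  rewrite !tnthS tnth_mktuple tnth_behead; congr (_ + tnth _ _).
  by apply/val_inj; rewrite /= inordK // ltnS.
by rewrite !tnth0.
Qed.

(** Under a Gaussian prior and Gaussian noise with independent coordinates, the
parameter and the noise in coordinate i can be integrated before all the
others: the noise is reordered first, then exchanged with the prior. *)
Lemma bayes_risk_coord_ge n (tau s : R) i (U : n.-tuple R * n.-tuple R -> \bar R)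
    (c : R) : 0 <= c ->
  measurable_fun setT U -> (forall y, 0 <= U y)%E ->
  (forall theta w, c%:E <= \int[normal_prob 0 tau]_t
     \int[normal_prob 0 s]_x U (set_coord theta i t, set_coord w i x))%E ->
  (c%:E <= \int[normal_vector tau (tuple_zero n)]_theta
     \int[normal_vector s (tuple_zero n)]_w U (theta, w))%E.
Proof.
move=> c0 mU U0 cU.
set P := normal_vector tau (tuple_zero n); set Q := normal_vector s (tuple_zero n).
have Qi : tnth (tuple_zero n) i = 0 by rewrite tnth_mktuple.
pose I (y : n.-tuple R * n.-tuple R) :=
  (\int[normal_prob 0 s]_x U (y.1, set_coord y.2 i x))%E.
have I0 y : (0 <= I y)%E by apply: integral_ge0.
have mI : measurable_fun setT I.
  apply: (measurable_fun_fubini_tonelli_F (m2 := normal_prob 0 s)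
    (fun yx => U (yx.1.1, set_coord yx.1.2 i yx.2))) => //.
  apply: measurableT_comp => //; apply: measurable_fun_pair => /=.
    by apply: measurableT_comp.
  by apply: measurable_set_coord => //; apply: measurableT_comp.
have le1 : (\int[P]_theta \int[Q]_w I (theta, w) <=
            \int[P]_theta \int[Q]_w U (theta, w))%E.
  apply: ge0_le_integral => //.
  - by move=> x _; apply: integral_ge0.
  - exact: measurable_fun_fubini_tonelli_F.
  - exact: measurable_fun_fubini_tonelli_F.
  move=> th _; apply: (ge0_le_integral_coord (i := i)) => //.
  - by apply: measurableT_comp => //; exact: measurable_pair1.
  - by apply: measurableT_comp => //; exact: measurable_pair1.
  move=> w; rewrite Qi (eq_integral (cst (I (th, w)))); last first.
    by move=> x _; rewrite /I/=; apply: eq_integral => y _; rewrite set_coord_set.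
  by rewrite integral_cst//= [X in (_ * X)%E]probability_setT mule1.
apply: le_trans le1; rewrite fubini_tonelli//.
rewrite -[leLHS]mule1 -(probability_setT Q) -integral_cst//.
apply: ge0_le_integral => //.
- exact: measurable_fun_fubini_tonelli_G.
move=> w _.
rewrite -[leLHS]mule1 -(probability_setT P) -integral_cst//.
apply: (ge0_le_integral_coord (i := i)) => //.
- by apply: measurableT_comp => //; exact: measurable_pair2.
move=> th; rewrite integral_cst// [X in (_ * X)%E]probability_setT mule1 Qi.
exact: cU.
Qed.

End more_coordinates.

(** * Stein's inequality with an even monotone weight *)

Section stein.
Context {R : realType}.
Notation mu := (@lebesgue_measure R).
Implicit Types (m s t x y : R).

Lemma is_derive_continuous (F F' : R -> R) :
  (forall x, is_derive x 1 F (F' x)) -> continuous F.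
Proof.
by move=> dF x; apply/differentiable_continuous/derivable1_diffP.
Qed.

Lemma cvg_symmetric_difference (F F' : R -> R) x :
  (forall x, is_derive x 1 F (F' x)) ->
  (F (x + harmonic k) - F (x - harmonic k)) / (2 * harmonic k) @[k --> \oo]
    --> F' x.
Proof.
move=> dF.
pose G := (F \o (fun h => x + h)) - (F \o (fun h => x - h)).
have dG : is_derive (0 : R) 1 G (2 * F' x).
  have d1 : is_derive (x + 0) 1 F (F' x) by rewrite addr0.
  have d2 : is_derive (x - 0) 1 F (F' x) by rewrite subr0.
  apply: is_derive_eq.
  by rewrite /= !(sub0r, add0r, mulr1, mulrN1) opprK; ring.
have [dG1 dG2] := dG; have := dG1; rewrite /derivable => /cvg_ex[l Gl].
have El : l = 2 * F' x by rewrite -dG2; apply/esym/cvg_lim.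
have /cvgr_dnbhsP/(_ harmonic) := Gl.
have hn0 : forall n, @harmonic R n != 0 by move=> n; rewrite invr_neq0// pnatr_eq0.
move=> /(_ (conj hn0 (@cvg_harmonic R))); rewrite El => H.
have H2 : ((harmonic n)^-1 *: ((G \o shift 0) (harmonic n)%:A - G 0)) / 2
    @[n --> \oo] --> (2 * F' x / 2 : R).
  by apply: cvgM; [exact: H|exact: cvg_cst].
rewrite (_ : F' x = 2 * F' x / 2); last by field.
apply: cvg_trans H2; apply: near_eq_cvg; apply: nearW => k.
rewrite /G /= !fctE /= !addr0 subr0 subrr subr0 /GRing.scale/= mulr1.
by rewrite invfM; ring.
Qed.

(** Since (x - m)^2 <= 2 (y - m)^2 + 2 (y - x)^2, a Gaussian near x is dominated by
a wider Gaussian at x. This gives the dominating function for difference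
quotients. *)
Lemma normal_fun_near m t x y : t != 0 -> `|y - x| <= 1 ->
  normal_fun m t y <= expR (1 / (t ^+ 2 *+ 2)) * normal_fun m (2 * t) x.
Proof.
move=> t0 xy; rewrite /normal_fun -expRD ler_expR.
have t2 : 0 < t ^+ 2 by rewrite exprn_even_gt0.
rewrite -subr_ge0 (_ : _ - _ =
  (4 - (x - m) ^+ 2 + 4 * (y - m) ^+ 2) / (8 * t ^+ 2)).
  apply: divr_ge0; last nra.
  have : (y - x) ^+ 2 <= 1 by rewrite -real_normK ?num_real// expr_le1.
  have : 0 <= ((y - m) + (y - x)) ^+ 2 by rewrite sqr_ge0.
  nra.
by field.
Qed.

Lemma integrable_normal_fun m t : t != 0 ->
  mu.-integrable setT (EFin \o normal_fun m t).
Proof.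
move=> t0; have := integrable_normal_pdf m t.
rewrite (_ : (fun x => _) = (fun x => (normal_peak t)%:E * (normal_fun m t x)%:E)%E).
  move=> h; have := integrableZl measurableT (normal_peak t)^-1 h.
  congr (_.-integrable _ _); apply/funext => x /=.
  have p0 : normal_peak t != 0 by rewrite gt_eqF// normal_peak_gt0.
  by rewrite muleA -!EFinM mulVf// mul1r.
by apply/funext => x; rewrite normal_pdfE.
Qed.

Lemma integrable_normal_bound m t K (f : R -> R) : t != 0 ->
  measurable_fun setT f -> (forall x, `|f x| <= K * normal_fun m t x) ->
  mu.-integrable setT (EFin \o f).
Proof.
move=> t0 mf fK.
apply: le_integrable (integrableZl measurableT K (integrable_normal_fun m t0)) => //.
  exact/measurable_EFinP.
move=> x _ /=; rewrite lee_fin.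
by apply: le_trans (fK x) _; exact: ler_norm.
Qed.

Lemma integral_le0 d (T : measurableType d) (nu : {measure set T -> \bar R})
    (f : T -> \bar R) :
  (forall w, f w <= 0)%E -> (\int[nu]_w f w <= 0)%E.
Proof.
move=> f0; rewrite integralE (eq_integral (cst 0%E)); last first.
  by move=> w wT; rewrite (le0_funeposE (D := setT)).
by rewrite integral0 sub0e oppe_le0; apply: integral_ge0.
Qed.

(** Translation invariance moves a symmetric difference from F to Phi: the
integrals of Phi x (F (x + u) - F (x - u)) and of
(Phi (x - u) - Phi (x + u)) F x are equal, and the second one is nonpositive.
Dividing by 2u and letting u tend to 0 gives the claim by dominated
convergence. *)
Lemma integral_mul_derive_le0 (F F' Phi : R -> R) (m t K M : R) : t != 0 ->
  (forall x, is_derive x 1 F (F' x)) ->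
  measurable_fun setT F' -> measurable_fun setT Phi ->
  (forall x, `|F x| <= K * normal_fun m t x) ->
  (forall x, `|F' x| <= K * normal_fun m t x) ->
  (forall x, `|Phi x| <= M) ->
  (forall u x : R, 0 < u -> (Phi (x - u) - Phi (x + u)) * F x <= 0) ->
  mu.-integrable setT (fun x => (Phi x * F' x)%:E) /\
  (\int[mu]_x (Phi x * F' x)%:E <= 0)%E.
Proof.
move=> t0 dF mF' mPhi FK F'K PhiM cond.
have cF := is_derive_continuous dF.
have mF : measurable_fun setT F by exact: continuous_measurable_fun.
have M0 : 0 <= M by apply: le_trans (PhiM 0).
have K0 : 0 <= K.
  have := le_trans (normr_ge0 _) (FK 0).
  by rewrite pmulr_lge0// expR_gt0.
have mFs u : measurable_fun setT (fun x => F (x + u)).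
  by apply: measurableT_comp => //; exact: measurable_funD.
have mPs u : measurable_fun setT (fun x => Phi (x + u)).
  by apply: measurableT_comp => //; exact: measurable_funD.
have iPF u : mu.-integrable setT (EFin \o (fun x => Phi (x + u) * F x)).
  apply: (@integrable_normal_bound m t (M * K)) => //.
    exact: measurable_funM.
  by move=> x; rewrite normrM -mulrA ler_pM.
have iPFs u : mu.-integrable setT (EFin \o (fun x => Phi x * F (x + u))).
  apply: (@integrable_normal_bound (m - u) t (M * K)) => //.
    exact: measurable_funM.
  move=> x; rewrite normrM -mulrA ler_pM//; apply: le_trans (FK _) _.
  by rewrite /normal_fun (_ : x + u - m = x - (m - u))//; ring.
have shift u : (\int[mu]_x (Phi x * F (x + u))%:E =
                \int[mu]_x (Phi (x - u) * F x)%:E)%E.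
  rewrite (@integral_translation _ (- u)); last exact: measurable_funM.
  by apply: eq_integral => x _; rewrite subrK.
have diff u : 0 < u ->
    (\int[mu]_x (Phi x * (F (x + u) - F (x - u)))%:E <= 0)%E.
  move=> u0.
  under eq_integral do rewrite mulrBr EFinB.
  rewrite integralB_EFin//.
  rewrite !shift opprK.
  rewrite -(integralB_EFin measurableT (iPF (- u)) (iPF u)).
  apply: integral_le0 => x.
  by rewrite -EFinB lee_fin -mulrBl; exact: cond.
set C := K * expR (1 / (t ^+ 2 *+ 2)).
pose f_ k x := (Phi x * ((F (x + harmonic k) - F (x - harmonic k)) / (2 * harmonic k)))%:E.
have hk k : 0 < harmonic k :> R by rewrite invr_gt0.
have hk1 k : harmonic k <= 1 :> R by rewrite invf_le1// ler1n.
have [] := @dominated_convergence _ _ _ mu setT measurableT f_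
  (fun x => (Phi x * F' x)%:E) (fun x => (M * C * normal_fun m (2 * t) x)%:E).
- move=> k; apply/measurable_EFinP; apply: measurable_funM => //.
  apply: measurable_funM => //.
  by apply: measurable_funB; exact: mFs.
- by apply/measurable_EFinP; exact: measurable_funM.
- apply: aeW => x _; apply: cvg_EFin; first by apply: nearW.
  by apply: cvgM; [exact: cvg_cst|exact: cvg_symmetric_difference].
- apply: (integrableZl measurableT (M * C) (integrable_normal_fun m _)).
  by rewrite mulf_neq0.
- apply: aeW => x k _; rewrite lee_fin normrM -mulrA ler_pM//.
  move: (hk k) (hk1 k); move: (harmonic k) => e e0 e1.
  have lt : x - e < x + e by lra.
  have [c cxk ->] := MVT lt (fun y _ => dF y) (continuous_subspaceT cF).
  rewrite (_ : x + _ - _ = 2 * e); last by ring.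
  rewrite mulfK; last by rewrite gt_eqF// mulr_gt0.
  apply: le_trans (F'K c) _; rewrite /C -mulrA ler_wpM2l//.
  apply: normal_fun_near => //.
  move: cxk; rewrite in_itv/= => /andP[? ?].
  by rewrite ler_norml; apply/andP; split; lra.
move=> iPF' _ lim; split => //.
rewrite -(cvg_lim _ lim)//; apply: lime_le; first by apply/cvg_ex; eexists; exact: lim.
apply: nearW => k; suff: (\int[mu]_x f_ k x <= 0)%E by [].
suff -> : (\int[mu]_x f_ k x = ((2 * harmonic k)^-1)%:E *
    \int[mu]_x (Phi x * (F (x + harmonic k) - F (x - harmonic k)))%:E)%E.
  apply: mule_ge0_le0; last exact: diff.
  by rewrite lee_fin invr_ge0 mulr_ge0// ltW.
rewrite -integralZl//.
  by apply: eq_integral => x _; rewrite /f_ -EFinM; congr (_%:E); ring.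
rewrite (_ : (fun x => _) = ((EFin \o (fun x => Phi x * F (x + harmonic k))%R) \-
  (EFin \o (fun x => Phi x * F (x + - harmonic k))%R))%E).
  exact: integrableB.
by apply/funext => x /=; rewrite mulrBr EFinB.
Qed.

End stein.

Section gaussian_stein.
Context {R : realType}.
Notation mu := (@lebesgue_measure R).
Implicit Types (m s t x y : R).

(** Doubling the standard deviation absorbs a quadratic factor: the quotient of
the two Gaussians is expR (- y) with y = 3/8 (x - m)^2 / s^2, and
expR y >= 1 + y. *)
Lemma sqr_normal_fun_le m s x : s != 0 ->
  (1 + (x - m) ^+ 2) * normal_fun m s x <=
  (1 + 8 / 3 * s ^+ 2) * normal_fun m (2 * s) x.
Proof.
move=> s0; have s2 : 0 < s ^+ 2 by rewrite exprn_even_gt0.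
set u := (x - m) ^+ 2; have u0 : 0 <= u by rewrite sqr_ge0.
have -> : normal_fun m s x =
    normal_fun m (2 * s) x * (expR (3 / 8 * u / s ^+ 2))^-1.
  by rewrite /normal_fun -expRN -expRD; congr expR; rewrite /u; field.
rewrite mulrCA [leRHS]mulrC ler_wpM2l ?expR_ge0//.
rewrite ler_pdivrMr ?expR_gt0//.
apply: le_trans (_ : (1 + 8 / 3 * s ^+ 2) * (1 + 3 / 8 * u / s ^+ 2) <= _).
  have -> : (1 + 8 / 3 * s ^+ 2) * (1 + 3 / 8 * u / s ^+ 2) =
      1 + u + (8 / 3 * s ^+ 2 + 3 / 8 * u / s ^+ 2) by field.
  by rewrite lerDl; apply: addr_ge0; [lra|apply: divr_ge0; lra].
by apply: ler_wpM2l; [lra|exact: expR_ge1Dx].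
Qed.

Lemma is_derive_normal_fun m s x : s != 0 ->
  is_derive x 1 (normal_fun m s) (- ((x - m) / s ^+ 2) * normal_fun m s x).
Proof.
move=> s0.
have -> : normal_fun m s = expR \o (fun y => - (s ^+ 2 *+ 2)^-1 * (y - m) ^+ 2).
  by apply/funext => y; rewrite /normal_fun/= mulrC mulrN mulNr mulrC.
apply: is_derive_eq.
by rewrite /= /GRing.scale/=; field.
Qed.

(** With F the product of h and the Gaussian, s^2 F' is
(s^2 h' - (x - m) h) times the Gaussian, so integral_mul_derive_le0 applies.
For constant Phi the last hypothesis holds for both h and - h, which gives the
identity of Stein. For Phi even and nondecreasing in |x|, and h of the sign of
x, the result is that identity for Phi h without its nonnegative term in the
derivative of Phi. *)
Lemma stein_inequality m s (h h' Phi : R -> R) (C M : R) : s != 0 ->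
  (forall x, is_derive x 1 h (h' x)) ->
  measurable_fun setT h' -> measurable_fun setT Phi ->
  (forall x, `|h x| <= C * (1 + `|x - m|)) -> (forall x, `|h' x| <= C) ->
  (forall x, `|Phi x| <= M) ->
  (forall u x : R, 0 < u -> (Phi (x - u) - Phi (x + u)) * h x <= 0) ->
  (normal_prob m s).-integrable setT
    (fun x => (Phi x * (s ^+ 2 * h' x - (x - m) * h x))%:E) /\
  (\int[normal_prob m s]_x
     (Phi x * (s ^+ 2 * h' x - (x - m) * h x))%:E <= 0)%E.
Proof.
move=> s0 dh mh' mPhi hC h'C PhiM cond.
have s2 : 0 < s ^+ 2 by rewrite exprn_even_gt0.
have C0 : 0 <= C by apply: le_trans (h'C 0).
have mh : measurable_fun setT h.
  by apply: continuous_measurable_fun; exact: is_derive_continuous dh.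
pose F := h * normal_fun m s.
pose F' x := (h' x - (x - m) / s ^+ 2 * h x) * normal_fun m s x.
have dF x : is_derive x 1 F (F' x).
  have ? := dh x; have ? := is_derive_normal_fun m x s0.
  rewrite /F; apply: is_derive_eq; rewrite /F' /GRing.scale/=; ring.
have mF' : measurable_fun setT F'.
  apply: measurable_funM; last exact: measurable_normal_fun.
  apply: measurable_funB => //; apply: measurable_funM => //.
  by apply: measurable_funM => //; exact: measurable_funB.
set D := 1 + 8 / 3 * s ^+ 2.
have D0 : 0 <= D by rewrite /D; lra.
have s2V : 0 < (s ^+ 2)^-1 by rewrite invr_gt0.
pose K := 2 * C * (1 + 2 / s ^+ 2) * D.
have FK x a : 0 <= a -> a <= 2 * C * (1 + 2 / s ^+ 2) * (1 + (x - m) ^+ 2) ->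
    a * normal_fun m s x <= K * normal_fun m (2 * s) x.
  move=> a0 aC.
  apply: (@le_trans _ _ (2 * C * (1 + 2 / s ^+ 2) *
      ((1 + (x - m) ^+ 2) * normal_fun m s x))).
    by rewrite mulrA ler_wpM2r ?normal_fun_ge0.
  rewrite /K -(mulrA (2 * C * (1 + 2 / s ^+ 2)) D).
  apply: ler_wpM2l; last exact: sqr_normal_fun_le.
  by rewrite mulr_ge0 ?mulr_ge0// addr_ge0// mulr_ge0// ltW.
have FK1 x : `|F x| <= K * normal_fun m (2 * s) x.
  rewrite /F normrM (ger0_norm (normal_fun_ge0 _ _ _)); apply: FK => //.
  apply: le_trans (hC x) _.
  rewrite -(real_normK (num_real (x - m))); move: `|x - m| (normr_ge0 (x - m)) => u u0.
  move: (s ^+ 2)^-1 s2V => v v0.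
  have -> : 2 * C * (1 + 2 * v) * (1 + u ^+ 2) =
    C * ((1 + 2 * v) * (2 * (1 + u ^+ 2))) by ring.
  rewrite ler_wpM2l//.
  have : 0 <= v * (1 + u ^+ 2) by rewrite mulr_ge0 ?addr_ge0 ?sqr_ge0// ltW.
  nra.
have FK2 x : `|F' x| <= K * normal_fun m (2 * s) x.
  rewrite /F' normrM (ger0_norm (normal_fun_ge0 _ _ _)); apply: FK => //.
  apply: le_trans (ler_normB _ _) _; rewrite !normrM (ger0_norm (ltW s2V)).
  have := hC x; have := h'C x.
  rewrite -(real_normK (num_real (x - m))).
  move: `|h x| (normr_ge0 (h x)) => b b0 h1 h2.
  move: `|x - m| h2 (normr_ge0 (x - m)) => u h2 u0.
  move: (s ^+ 2)^-1 s2V => v v0.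
  apply: (@le_trans _ _ (C + u * v * (C * (1 + u)))).
    by rewrite lerD// ler_wpM2l// mulr_ge0// ltW.
  have -> : C + u * v * (C * (1 + u)) = C * (1 + v * (u * (1 + u))) by ring.
  have -> : 2 * C * (1 + 2 * v) * (1 + u ^+ 2) =
    C * ((1 + 2 * v) * (2 * (1 + u ^+ 2))) by ring.
  rewrite ler_wpM2l//.
  have : v * (u * (1 + u)) <= v * (4 * (1 + u ^+ 2)).
    by rewrite ler_wpM2l// ?ltW//; nra.
  nra.
have cond' u x : 0 < u -> (Phi (x - u) - Phi (x + u)) * F x <= 0.
  move=> u0; rewrite /F mulrA; apply: mulr_le0_ge0; last exact: normal_fun_ge0.
  exact: cond.
have s20 : 2 * s != 0 by rewrite mulf_neq0.
have [iF leF] := integral_mul_derive_le0 s20 dF mF' mPhi FK1 FK2 PhiM cond'.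
have mG : measurable_fun setT (fun x => Phi x * (s ^+ 2 * h' x - (x - m) * h x)).
  apply: measurable_funM => //; apply: measurable_funB.
    exact: measurable_funM.
  by apply: measurable_funM => //; exact: measurable_funB.
set c := s ^+ 2 * normal_peak s.
have c0 : 0 <= c by rewrite mulr_ge0 ?normal_peak_ge0// ltW.
have E x : Phi x * (s ^+ 2 * h' x - (x - m) * h x) * normal_pdf m s x =
    c * (Phi x * F' x).
  by rewrite normal_pdfE//= /c /F'; field.
split.
- apply/integrableP; split; first exact/measurable_EFinP.
  under eq_integral do rewrite /=.
  rewrite (@integral_normal_prob _ m s
    (fun x => `|Phi x * (s ^+ 2 * h' x - (x - m) * h x)|)); last first.
    exact: measurableT_comp.
  have := integrableZl measurableT c iF => /integrableP[_].
  apply: le_lt_trans; apply: ge0_le_integral => //=.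
  + by move=> x _; rewrite lee_fin mulr_ge0// normal_pdf_ge0.
  + apply/measurable_EFinP/measurable_funM; last exact: measurable_normal_pdf.
    exact: measurableT_comp.
  + apply/measurable_EFinP; apply: measurableT_comp => //.
    by apply: measurable_funM => //; exact: measurable_funM.
  + move=> x _; rewrite lee_fin.
    by rewrite -(ger0_norm (normal_pdf_ge0 m s x)) -normrM E.
- rewrite integral_normal_prob//.
  under eq_integral do rewrite E EFinM.
  by rewrite integralZl//; apply: mule_ge0_le0.
Qed.

End gaussian_stein.

(** * Bayes risk under Gaussian priors and the lower bound *)

Section bayes.
Context {R : realType}.
Notation mu := (@lebesgue_measure R).
Implicit Types (m s t x y c : R).

Lemma integral_normal_prob_cst m s c :
  (\int[normal_prob m s]_x c%:E = c%:E)%E.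
Proof. by rewrite integral_cst//= [X in (_ * X)%E]probability_setT mule1. Qed.

(** Stein with h t = (t - m) + 2a, where a = m - c: the square (c - t)^2 equals
s^2 + a^2 minus the integrand of stein_inequality. *)
Lemma normal_sqr_error_ge m s c : s != 0 ->
  ((s ^+ 2)%:E <= \int[normal_prob m s]_t ((c - t) ^+ 2)%:E)%E.
Proof.
move=> s0; pose a := m - c.
have [] := @stein_inequality R m s (fun t => (t - m) + 2 * a) (cst 1) (cst 1)
  (1 + `|2 * a|) 1 s0.
- by move=> x; apply: is_derive_eq; rewrite subr0 addr0.
- exact: measurable_cst.
- exact: measurable_cst.
- move=> x; apply: le_trans (ler_normD _ _) _.
  have := normr_ge0 (x - m); have := normr_ge0 (2 * a).
  move: `|x - m| `|2 * a| => u v; nra.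
- by move=> x; rewrite normr1 lerDl.
- by move=> x; rewrite normr1.
- by move=> u x _; rewrite subrr mul0r.
set G := (fun x => _) => iG leG.
have icst : (normal_prob m s).-integrable setT (cst (s ^+ 2 + a ^+ 2)%:E).
  exact: finite_measure_integrable_cst.
have -> : (\int[normal_prob m s]_t ((c - t) ^+ 2)%:E =
    \int[normal_prob m s]_t ((cst (s ^+ 2 + a ^+ 2)%:E) t - G t))%E.
  by apply: eq_integral => t _; rewrite /G/= -EFinB; congr (_%:E); rewrite /a; ring.
rewrite integralB//= integral_normal_prob_cst leeBrDr; last first.
  exact: integrable_fin_num.
apply: (@le_trans _ _ ((s ^+ 2)%:E + 0)%E); first exact: leeD2l.
by rewrite adde0 lee_fin lerDl sqr_ge0.
Qed.

(** Stein with h t = m - t. *)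
Lemma normal_sqr_dev_le m s : s != 0 ->
  (normal_prob m s).-integrable setT (fun t => ((t - m) ^+ 2)%:E) /\
  (\int[normal_prob m s]_t ((t - m) ^+ 2)%:E <= (s ^+ 2)%:E)%E.
Proof.
move=> s0.
have [] := @stein_inequality R m s (fun t => m - t) (cst (- 1)) (cst 1) 1 1 s0.
- by move=> x; apply: is_derive_eq; rewrite add0r mul1r.
- exact: measurable_cst.
- exact: measurable_cst.
- by move=> x; rewrite distrC mul1r lerDr.
- by move=> x; rewrite normrN1.
- by move=> x; rewrite normr1.
- by move=> u x _; rewrite subrr mul0r.
set G := (fun x => _) => iG leG.
have icst : (normal_prob m s).-integrable setT (cst (s ^+ 2)%:E).
  exact: finite_measure_integrable_cst.
have E : (fun t => ((t - m) ^+ 2)%:E) = (cst (s ^+ 2)%:E \+ G)%E.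
  by apply/funext => t; rewrite /G /= -EFinD; congr (_%:E); ring.
rewrite E; split; first exact: integrableD.
rewrite integralD//= integral_normal_prob_cst.
by rewrite -[leRHS]adde0 leeD2l.
Qed.

Lemma normal_peakM s t : normal_peak s * normal_peak t =
  (`|s| * `|t| * (pi *+ 2))^-1 :> R.
Proof.
have E u : normal_peak u = (`|u| * Num.sqrt (pi *+ 2))^-1 :> R.
  by rewrite /normal_peak -mulrnAr sqrtrM ?sqr_ge0// sqrtr_sqr.
have p0 : 0 <= pi *+ 2 :> R by rewrite mulrn_wge0// pi_ge0.
by rewrite !E -invfM mulrACA -expr2 sqr_sqrtr.
Qed.

(** The rule of Bayes for a Gaussian mean y with a Gaussian prior: the joint
density is the marginal density of the observation x times the posterior
density of y. *)
Lemma normal_pdf_posterior (s t x y : R) : 0 < s -> 0 < t ->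
  let r := Num.sqrt (s ^+ 2 + t ^+ 2) in
  normal_pdf y s x * normal_pdf 0 t y =
  normal_pdf 0 r x * normal_pdf (t ^+ 2 / r ^+ 2 * x) (s * t / r) y.
Proof.
move=> s0 t0 r.
have r2 : r ^+ 2 = s ^+ 2 + t ^+ 2 by rewrite sqr_sqrtr// addr_ge0// sqr_ge0.
have r0 : 0 < r by rewrite sqrtr_gt0 addr_gt0// exprn_gt0.
have q0 : 0 < s * t / r by rewrite divr_gt0// mulr_gt0.
rewrite !normal_pdfE ?gt_eqF//= mulrACA [RHS]mulrACA !normal_peakM.
have -> : `|r| * `|s * t / r| = `|s| * `|t|.
  by rewrite !gtr0_norm// mulrC divfK// gt_eqF.
congr (_ * _); rewrite /normal_fun -!expRD; congr expR.
have s2 : s ^+ 2 = r ^+ 2 - t ^+ 2 by rewrite r2 addrK.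
rewrite expr_div_n exprMn.
have : s ^+ 2 != 0 by rewrite gt_eqF// exprn_gt0.
move=> s2n0; rewrite s2 in s2n0 *; field.
by rewrite s2n0 !gt_eqF.
Qed.

(** Given the observation, the mean square error of any guess f is at least the
posterior variance, which does not depend on the observation. *)
Lemma bayes_risk_1d_ge (s t : R) (f : R -> R) : 0 < s -> 0 < t ->
  measurable_fun setT f ->
  ((s ^+ 2 * t ^+ 2 / (s ^+ 2 + t ^+ 2))%:E <=
   \int[normal_prob 0%R t]_y \int[normal_prob 0%R s]_x
     ((f (x + y)%R - y) ^+ 2)%:E)%E.
Proof.
move=> s0 t0 mf; set q := (_ / _).
have q_ge0 : 0 <= q.
  by apply: divr_ge0; [apply: mulr_ge0|apply: addr_ge0]; exact: sqr_ge0.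
have s1 : s != 0 by rewrite gt_eqF.
pose r := Num.sqrt (s ^+ 2 + t ^+ 2).
have r2 : r ^+ 2 = s ^+ 2 + t ^+ 2 by rewrite sqr_sqrtr// addr_ge0// sqr_ge0.
have r0 : 0 < r by rewrite sqrtr_gt0 addr_gt0// exprn_gt0.
have m1 (g : R -> R) y : measurable_fun setT (fun x => (f x - g y) ^+ 2).
  by apply: measurable_funX; exact: measurable_funB.
have m2 x : measurable_fun setT (fun y => (f x - y) ^+ 2).
  by apply: measurable_funX; exact: measurable_funB.
have inner y : (\int[normal_prob 0%R s]_x ((f (x + y)%R - y) ^+ 2)%:E =
    \int[mu]_x ((f x - y) ^+ 2 * normal_pdf y s x)%:E)%E.
  rewrite -integral_normal_prob; last exact: (m1 id).
  rewrite (@ge0_integral_normal_prob_shift _ y s (fun x => ((f x - y) ^+ 2)%:E))//.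
    by apply/measurable_EFinP; exact: (m1 id).
  by move=> x; rewrite lee_fin sqr_ge0.
have minner : measurable_fun setT (fun yx : R * R =>
    (f yx.2 - yx.1) ^+ 2 * normal_pdf yx.1 s yx.2).
  apply: measurable_funM.
    apply: measurable_funX; apply: measurable_funB => //.
    exact: measurableT_comp.
  rewrite (_ : (fun _ => _) = normal_pdf 0 s \o (fun yx => yx.2 - yx.1)).
    apply: measurableT_comp; first exact: measurable_normal_pdf.
    exact: measurable_funB.
  apply/funext => -[y x] /=; rewrite -[in RHS](normal_pdf_translation y)//.
  by rewrite subrK.
pose G (yx : R * R) := ((f yx.2 - yx.1) ^+ 2 * normal_pdf yx.1 s yx.2 *
  normal_pdf 0 t yx.1)%:E.
have mG : measurable_fun setT G.
  apply/measurable_EFinP; apply: measurable_funM => //.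
  exact: (measurableT_comp (measurable_normal_pdf 0 t) measurable_fst).
have G0 yx : (0 <= G yx)%E.
  rewrite lee_fin; apply: mulr_ge0; last exact: normal_pdf_ge0.
  by apply: mulr_ge0; [exact: sqr_ge0|exact: normal_pdf_ge0].
have -> : (\int[normal_prob 0%R t]_y \int[normal_prob 0%R s]_x
     ((f (x + y)%R - y) ^+ 2)%:E = \int[mu]_y \int[mu]_x G (y, x))%E.
  under eq_integral do rewrite inner.
  pose W (yx : R * R) := ((f yx.2 - yx.1) ^+ 2 * normal_pdf yx.1 s yx.2)%:E.
  have mW : measurable_fun setT W by exact/measurable_EFinP.
  have W0 yx : (0 <= W yx)%E.
    by rewrite lee_fin; apply: mulr_ge0; [exact: sqr_ge0|exact: normal_pdf_ge0].
  rewrite (@ge0_integral_normal_prob _ 0 t (fun y => \int[mu]_x W (y, x))%E).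
  - apply: eq_integral => y _; rewrite -ge0_integralZr//.
    + by apply: measurableT_comp => //; exact: measurable_pair1.
    + by rewrite lee_fin normal_pdf_ge0.
  - exact: (measurable_fun_fubini_tonelli_F (m2 := mu) W mW W0).
  - by move=> y; apply: integral_ge0 => x _; exact: W0.
rewrite fubini_tonelli//.
pose rho := s * t / r; pose k := t ^+ 2 / r ^+ 2.
have rho0 : rho != 0 by rewrite gt_eqF// divr_gt0// mulr_gt0.
have inner2 x : ((q * normal_pdf 0 r x)%:E <= \int[mu]_y G (y, x))%E.
  have -> : (\int[mu]_y G (y, x) = (normal_pdf 0 r x)%:E *
      \int[normal_prob (k * x) rho]_y ((f x - y) ^+ 2)%:E)%E.
    rewrite integral_normal_prob// -ge0_integralZl//.
    - apply: eq_integral => y _; rewrite /G/= -EFinM; congr (_%:E).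
      by rewrite -mulrA normal_pdf_posterior// mulrCA.
    - apply/measurable_EFinP; apply: measurable_funM; first exact: m2.
      exact: (measurable_normal_pdf (k * x) rho).
    - by move=> y _; rewrite lee_fin mulr_ge0 ?sqr_ge0 ?normal_pdf_ge0.
    - by rewrite lee_fin normal_pdf_ge0.
  rewrite mulrC EFinM; apply: lee_wpmul2l; first by rewrite lee_fin normal_pdf_ge0.
  rewrite (_ : q = rho ^+ 2); first exact: normal_sqr_error_ge.
  by rewrite /q /rho -r2 expr_div_n exprMn.
apply: (@le_trans _ _ (\int[mu]_x (q * normal_pdf 0 r x)%:E)%E).
  under eq_integral do rewrite EFinM.
  rewrite ge0_integralZl//.
  - by rewrite integral_normal_pdf mule1.
  - by apply/measurable_EFinP; exact: measurable_normal_pdf.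
  - by move=> x _; rewrite lee_fin normal_pdf_ge0.
apply: ge0_le_integral => //.
- by move=> x _; rewrite lee_fin mulr_ge0 ?normal_pdf_ge0.
- apply/measurable_EFinP; apply: measurable_funM => //.
  exact: measurable_normal_pdf.
- exact: measurable_fun_fubini_tonelli_G.
Qed.

End bayes.

Section lower_bound.
Context {R : realType}.
Implicit Types (s t : R).

Lemma tuple_add_set_coord n (z w : n.-tuple R) i x y :
  tuple_add (set_coord z i x) (set_coord w i y) = set_coord (tuple_add z w) i (x + y).
Proof.
apply/eq_from_tnth => j; rewrite tnth_mktuple !tnth_set_coord tnth_mktuple.
by case: (j == i).
Qed.

Section bayes_risk.
Variables (n : nat) (s : R) (delta : n.-tuple R -> n.-tuple R).
Hypotheses (s0 : 0 < s) (mdelta : measurable_fun setT delta).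

(** The pair consists of a parameter theta and a noise w, so that the observation
is theta + w. *)
Definition sqr_err i (y : n.-tuple R * n.-tuple R) : \bar R :=
  ((tnth (delta (tuple_add y.2 y.1)) i - tnth y.1 i) ^+ 2 / s ^+ 2)%:E.

Lemma measurable_sqr_err i : measurable_fun setT (sqr_err i).
Proof.
apply/measurable_EFinP; apply: measurable_funM => //.
apply: measurable_funX; apply: measurable_funB.
  apply: (measurableT_comp (measurable_tnth i)).
  apply: (measurableT_comp mdelta); exact: measurable_tuple_add.
by apply: (measurableT_comp (measurable_tnth i)).
Qed.

Lemma sqr_err_ge0 i y : (0 <= sqr_err i y)%E.
Proof. by rewrite lee_fin divr_ge0 ?sqr_ge0. Qed.

Lemma risk_sqr_err theta : risk s delta theta =
  (\int[normal_vector s (tuple_zero n)]_w \sum_(i < n) sqr_err i (theta, w))%E.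
Proof.
rewrite /risk unlock.
rewrite [LHS](@ge0_integral_normal_vector_shift _ n s theta
  (fun z => (loss s (delta z) theta)%:E)).
- by apply: eq_integral => w _; rewrite /loss /sqr_err sumEFin.
- by rewrite gt_eqF.
- apply/measurable_EFinP; apply: measurable_sum => i.
  apply: measurable_funM => //; apply: measurable_funX; apply: measurable_funB => //.
  exact: (measurableT_comp (measurable_tnth i)).
- by move=> z; rewrite lee_fin; apply: sumr_ge0 => i _; rewrite divr_ge0 ?sqr_ge0.
Qed.

Lemma bayes_risk_sqr_err_ge t i : 0 < t ->
  ((t ^+ 2 / (s ^+ 2 + t ^+ 2))%:E <= \int[normal_vector t (tuple_zero n)]_theta
     \int[normal_vector s (tuple_zero n)]_w sqr_err i (theta, w))%E.
Proof.
move=> t0; apply: (bayes_risk_coord_ge (i := i)).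
- by rewrite divr_ge0 ?addr_ge0 ?sqr_ge0.
- exact: measurable_sqr_err.
- exact: sqr_err_ge0.
move=> theta w.
pose f x := tnth (delta (set_coord (tuple_add w theta) i x)) i.
have mf : measurable_fun setT f.
  apply: (measurableT_comp (measurable_tnth i)).
  apply: (measurableT_comp mdelta); exact: measurable_set_coord.
have s2 : 0 <= (s ^+ 2)^-1 by rewrite invr_ge0 sqr_ge0.
pose V (yx : R * R) := ((f (yx.2 + yx.1) - yx.1) ^+ 2)%:E.
have mV : measurable_fun setT V.
  apply/measurable_EFinP; apply: measurable_funX; apply: measurable_funB => //.
  by apply: measurableT_comp => //; exact: measurable_funD.
have V0 yx : (0 <= V yx)%E by rewrite lee_fin sqr_ge0.
have -> : (\int[normal_prob 0%R t]_y \int[normal_prob 0%R s]_x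
      sqr_err i (set_coord theta i y, set_coord w i x) =
    (\int[normal_prob 0%R t]_y \int[normal_prob 0%R s]_x V (y, x)) *
      (s ^+ 2)^-1%:E)%E.
  rewrite -ge0_integralZr//.
  - apply: eq_integral => y _; rewrite -ge0_integralZr//.
    + apply: eq_integral => x _; rewrite /sqr_err /V /f/= tuple_add_set_coord -EFinM.
      by rewrite tnth_set_coord eqxx.
    + by apply: measurableT_comp => //; exact: measurable_pair1.
  - exact: (measurable_fun_fubini_tonelli_F (m2 := normal_prob 0 s) V mV V0).
  - by move=> y _; exact: integral_ge0.
have := lee_wpmul2r (_ : 0 <= (s ^+ 2)^-1%:E)%E (bayes_risk_1d_ge s0 t0 mf).
rewrite lee_fin -EFinM => /(_ s2); apply: le_trans.
rewrite lee_fin le_eqVlt; apply/orP; left; apply/eqP; field.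
by rewrite !gt_eqF// addr_gt0// exprn_gt0.
Qed.

(** The supremum of the risk dominates its average over the prior N(0, t^2 I),
and each coordinate contributes a posterior variance to that average. *)
Lemma sup_risk_ge_bayes t : 0 < t ->
  ((n%:R * (t ^+ 2 / (s ^+ 2 + t ^+ 2)))%:E <= sup_risk s delta)%E.
Proof.
move=> t0; set P := normal_vector t (tuple_zero n).
set Q := normal_vector s (tuple_zero n).
apply: (@le_trans _ _ (\int[P]_theta \int[Q]_w \sum_(i < n) sqr_err i (theta, w))%E).
  rewrite (_ : (\int[P]_theta _)%E =
    (\sum_(i < n) \int[P]_theta \int[Q]_w sqr_err i (theta, w))%E).
    apply: (@le_trans _ _ (\sum_(i < n) (t ^+ 2 / (s ^+ 2 + t ^+ 2))%:E)%E).
      by rewrite sumEFin sumr_const card_ord mulr_natl.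
    by apply: lee_sum => i _; exact: bayes_risk_sqr_err_ge.
  rewrite -ge0_integral_sum//.
  - apply: eq_integral => theta _; rewrite ge0_integral_sum//.
    + move=> i; apply: measurableT_comp; first exact: measurable_sqr_err.
      exact: measurable_pair1.
    + by move=> i w _; exact: sqr_err_ge0.
  - move=> i; apply: measurable_fun_fubini_tonelli_F.
      exact: measurable_sqr_err.
    exact: sqr_err_ge0.
  - by move=> i w _; apply: integral_ge0 => *; exact: sqr_err_ge0.
have sup_ge0 : (0 <= sup_risk s delta)%E.
  apply: (@le_trans _ _ (risk s delta (tuple_zero n))); last first.
    by apply: ereal_sup_ubound; exists (tuple_zero n).
  rewrite risk_sqr_err; apply: integral_ge0 => w _.
  by apply: sume_ge0 => i _; exact: sqr_err_ge0.
rewrite -[leRHS]mule1 -(probability_setT P) -integral_cst//.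
apply: ge0_le_integral => //.
- move=> th _; apply: integral_ge0 => w _.
  by apply: sume_ge0 => i _; exact: sqr_err_ge0.
- apply: (measurable_fun_fubini_tonelli_F (fun y => \sum_(i < n) sqr_err i y)%E).
    by apply: emeasurable_sum => i; exact: measurable_sqr_err.
  by move=> y; apply: sume_ge0 => i _; exact: sqr_err_ge0.
- move=> th _; rewrite -risk_sqr_err.
  by apply: ereal_sup_ubound; exists th.
Qed.

End bayes_risk.

(** Flatter and flatter priors make the posterior variance tend to s^2. *)
Lemma sup_risk_ge n s (delta : n.-tuple R -> n.-tuple R) : 0 < s ->
  measurable_fun setT delta -> (n%:R%:E <= sup_risk s delta)%E.
Proof.
move=> s0 md; rewrite leNgt; apply/negP => lt.
have := sup_risk_ge_bayes s0 md.
move: (sup_risk s delta) lt => [b | |]; last 2 first.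
- by rewrite ltNge leey.
- by move=> _ /(_ 1 ltr01).
rewrite lte_fin => bn ge.
have nb : 0 < n%:R - b by rewrite subr_gt0.
have q0 : 0 <= `|b| * s ^+ 2 / (n%:R - b).
  by apply: divr_ge0; [apply: mulr_ge0 => //; exact: sqr_ge0|exact: ltW].
(* For this t the Bayes risk n t^2 / (s^2 + t^2) exceeds b. *)
pose t := 1 + `|b| * s ^+ 2 / (n%:R - b).
have t0 : 0 < t by rewrite ltr_pwDl.
have := ge _ t0; rewrite lee_fin leNgt => /negP; apply.
have s2 : 0 < s ^+ 2 by rewrite exprn_gt0.
have st : 0 < s ^+ 2 + t ^+ 2 by rewrite addr_gt0// exprn_gt0.
rewrite mulrA ltr_pdivlMr//.
have tE : (t - 1) * (n%:R - b) = `|b| * s ^+ 2.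
  by rewrite /t addrAC subrr add0r divfK// gt_eqF// subr_gt0.
have t1 : 1 <= t by rewrite lerDl.
have bs : b * s ^+ 2 <= `|b| * s ^+ 2 by rewrite ler_wpM2r ?ler_norm// ltW.
have : (t - 1) * (n%:R - b) < t ^+ 2 * (n%:R - b).
  by rewrite ltr_pM2r//; nra.
rewrite tE => /(le_lt_trans bs); clearbody t => lt2.
lra.
Qed.

End lower_bound.

(** * The pointwise inequality behind the bound on phi *)

Section inequalities.
Context {R : realType}.
Implicit Types (x y r : R).

(** Sum (f i - f j) (g i - g j) over all pairs. *)
Lemma chebyshev_sum n (f g : 'I_n -> R) :
  (forall i j, (f i - f j) * (g i - g j) <= 0) ->
  n%:R * (\sum_i f i * g i) <= (\sum_i f i) * (\sum_i g i).
Proof.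
move=> fg.
have : \sum_(i < n) \sum_(j < n) ((f i - f j) * (g i - g j)) <= 0.
  by apply: sumr_le0 => i _; apply: sumr_le0.
have -> : \sum_(i < n) \sum_(j < n) ((f i - f j) * (g i - g j)) =
    (n%:R * (\sum_i f i * g i) - (\sum_i f i) * (\sum_i g i)) *+ 2.
  transitivity (\sum_(i < n) \sum_(j < n) (f i * g i) +
      \sum_(i < n) \sum_(j < n) (f j * g j) -
      (\sum_(i < n) \sum_(j < n) f i * g j) -
      (\sum_(i < n) \sum_(j < n) f j * g i)).
    rewrite -big_split/= -!sumrB; apply: eq_bigr => i _.
    rewrite -big_split/= -!sumrB; apply: eq_bigr => j _; ring.
  have -> : \sum_(i < n) \sum_(j < n) f j * g i = \sum_(i < n) \sum_(j < n) f i * g j.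
    by rewrite exchange_big.
  have -> : \sum_(i < n) \sum_(j < n) f i * g i = n%:R * \sum_i f i * g i.
    rewrite mulr_sumr; apply: eq_bigr => i _.
    by rewrite sumr_const card_ord mulr_natl.
  have -> : \sum_(i < n) \sum_(j < n) f j * g j = n%:R * \sum_i f i * g i.
    by rewrite sumr_const card_ord mulr_natl.
  have -> : \sum_(i < n) \sum_(j < n) f i * g j = (\sum_i f i) * (\sum_i g i).
    by rewrite mulr_suml; apply: eq_bigr => i _; rewrite mulr_sumr.
  ring.
by rewrite pmulrn_lle0// subr_le0.
Qed.

Lemma powR_le_neg r x y : r <= 0 -> 0 < x -> x <= y -> y `^ r <= x `^ r.
Proof.
move=> r0 x0 xy; have y0 : 0 < y by apply: lt_le_trans xy.
rewrite -(opprK r) powRN (powRN x) lef_pV2 ?posrE ?powR_gt0//.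
by apply: ge0_ler_powR; rewrite ?nnegrE ?oppr_ge0// ltW.
Qed.

Lemma powR_opposite x y r r' : 0 < x -> 0 < y -> 0 <= r -> r' <= 0 ->
  (x `^ r - y `^ r) * (x `^ r' - y `^ r') <= 0.
Proof.
move=> x0 y0 r0 r'0; have [xy|/ltW yx] := leP x y.
  apply: mulr_le0_ge0; first by rewrite subr_le0; apply: ge0_ler_powR; rewrite ?nnegrE// ltW.
  by rewrite subr_ge0 powR_le_neg.
apply: mulr_ge0_le0; first by rewrite subr_ge0; apply: ge0_ler_powR; rewrite ?nnegrE// ltW.
by rewrite subr_le0 powR_le_neg.
Qed.

Lemma sum_powR_ge1 n (u : 'I_n -> R) r : (forall i, 0 < u i) -> 1 <= r ->
  \sum_i u i `^ r <= (\sum_i u i) `^ r.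
Proof.
move=> u0 r1.
have S0 : 0 <= \sum_i u i by apply: sumr_ge0 => i _; exact: ltW.
have uS i : u i <= \sum_i u i.
  by rewrite (bigD1 i)//= lerDl; apply: sumr_ge0 => j _; exact: ltW.
have r0 : r != 0 by rewrite gt_eqF// (lt_le_trans ltr01).
rewrite -(mulr_powRB1 S0); last exact: lt_le_trans r1.
rewrite mulr_suml; apply: ler_sum => i _.
rewrite -(mulr_powRB1 (ltW (u0 i))); last exact: lt_le_trans r1.
apply: ler_wpM2l; first exact: ltW.
by apply: ge0_ler_powR; rewrite ?nnegrE ?subr_ge0// ltW.
Qed.

(** Concavity of the power function, from expR x >= 1 + x at (1 - r) ln x and at
- r ln x. *)
Lemma powR_le_tangent x r : 0 < x -> 0 <= r <= 1 -> x `^ r <= 1 + r * (x - 1).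
Proof.
move=> x0 /andP[r0 r1]; rewrite /powR gt_eqF//.
rewrite -[in leRHS](lnK x0); set y := ln x.
have -> : 1 + r * (expR y - 1) =
    expR (r * y) * (r * expR ((1 - r) * y) + (1 - r) * expR (- (r * y))).
  rewrite [RHS]mulrDr mulrCA -expRD [X in _ = _ + X]mulrCA -expRD subrr expR0.
  by rewrite (_ : r * y + _ = y); ring.
rewrite ler_peMr ?expR_ge0//.
have h1 := expR_ge1Dx ((1 - r) * y); have h2 := expR_ge1Dx (- (r * y)).
apply: (@le_trans _ _ (r * (1 + (1 - r) * y) + (1 - r) * (1 - r * y))).
  by rewrite le_eqVlt; apply/orP; left; apply/eqP; ring.
by rewrite lerD// ler_wpM2l// subr_ge0.
Qed.

(** Apply the tangent bound at the mean m of the u i. *)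
Lemma sum_powR_le1 n (u : 'I_n.+1 -> R) r : (forall i, 0 < u i) -> 0 <= r <= 1 ->
  n.+1%:R `^ (r - 1) * \sum_i u i `^ r <= (\sum_i u i) `^ r.
Proof.
move=> u0 r01.
have S0 : 0 < \sum_i u i.
  by rewrite big_ord_recl ltr_wpDr//; apply: sumr_ge0 => j _; exact: ltW.
have n0 : 0 < n.+1%:R :> R by [].
set S := \sum_i u i in S0 *; pose m := S / n.+1%:R.
have m0 : 0 < m by rewrite divr_gt0.
have : \sum_i (u i / m) `^ r <= \sum_(i < n.+1) (1 + r * (u i / m - 1)).
  by apply: ler_sum => i _; rewrite powR_le_tangent// divr_gt0.
have -> : \sum_(i < n.+1) (1 + r * (u i / m - 1)) = n.+1%:R.
  rewrite big_split/= sumr_const card_ord -mulr_sumr sumrB -mulr_suml.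
  rewrite sumr_const card_ord -/S /m invfM invrK mulrA divff ?gt_eqF// mul1r.
  by rewrite subrr mulr0 addr0.
have -> : \sum_i (u i / m) `^ r = (\sum_i u i `^ r) / m `^ r.
  rewrite mulr_suml; apply: eq_bigr => i _.
  rewrite powRM ?invr_ge0 ?ltW//; congr (_ * _).
  by rewrite -powR_inv1 ?ltW// -powRrM mulN1r powRN.
rewrite ler_pdivrMr ?powR_gt0// => h.
have -> : S `^ r = n.+1%:R `^ (r - 1) * (n.+1%:R * m `^ r).
  rewrite mulrA [_ * n.+1%:R]mulrC powRB; last first.
    by apply/implyP => _; rewrite gt_eqF.
  rewrite powRr1 ?ltW// mulrCA divff ?gt_eqF// mulr1 -powRM ?ltW//.
  by rewrite /m mulrCA divff ?gt_eqF// mulr1.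
by rewrite ler_wpM2l// powR_ge0.
Qed.

(** The two comparisons between power sums, for exponents above and below 1, are
the origin of the minimum in gamma. *)
Lemma min_sum_powR n (u : 'I_n.+1 -> R) r : (forall i, 0 < u i) -> 0 <= r ->
  Num.min 1 (n.+1%:R `^ (r - 1)) * \sum_i u i `^ r <= (\sum_i u i) `^ r.
Proof.
move=> u0 r0; have s0 : 0 <= \sum_i u i `^ r by apply: sumr_ge0 => i _; exact: powR_ge0.
have [r1|/ltW r1] := leP r 1.
  apply: le_trans (sum_powR_le1 u0 _); last by rewrite r0.
  by rewrite ler_wpM2r// ge_min lexx orbT.
apply: le_trans (sum_powR_ge1 u0 r1).
by rewrite ler_piMl// ge_min lexx.
Qed.

(** The inequality is about the vector field with components
S^((alpha - 2)/p) q_i^(- alpha/2) z_i, where S is the sum of the q_i^(p/2).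
For q_i = z_i^2 this is the direction z_i / (|z|_p^(2 - alpha) |z_i|^alpha) of
the shrinkage. Only z_i^2 <= q_i is assumed, to leave room for smoothing. *)
Section pointwise.
Variables (n : nat) (p alpha : R).
Hypotheses (p0 : 0 < p) (n3 : (3 <= n.+1)%N) (a0 : 0 <= alpha)
  (a1 : alpha < (n.+1%:R - 2) / (n.+1%:R - 1)).

Let d : R := n.+1%:R.

Let d3 : 3 <= d.
Proof. by rewrite /d ler_nat. Qed.

Let kappa_gt0 : 0 < d - 2 - alpha * (d - 1).
Proof.
rewrite subr_gt0 -ltr_pdivlMr//.
by have := d3; lra.
Qed.

Let alpha_lt1 : alpha < 1.
Proof.
apply: lt_trans a1 _; rewrite -/d ltr_pdivrMr ?mul1r; first by lra.
by have := d3; lra.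
Qed.

Section q.
Variables (q z : 'I_n.+1 -> R).
Hypotheses (q0 : forall i, 0 < q i) (zq : forall i, z i ^+ 2 <= q i).

Let S := \sum_i q i `^ (p / 2).
Let E := S `^ ((alpha - 2) / p).
Let T := \sum_i q i `^ (- alpha / 2).
Let S0 : 0 < S.
Proof.
rewrite /S big_ord_recl ltr_wpDr ?powR_gt0//.
by apply: sumr_ge0 => j _; exact: powR_ge0.
Qed.
Let E0 : 0 < E. Proof. exact: powR_gt0. Qed.
Let T0 : 0 <= T. Proof. by apply: sumr_ge0 => i _; exact: powR_ge0. Qed.

Let chebT r : 0 <= r ->
  d * (\sum_i q i `^ r * q i `^ (- alpha / 2)) <= (\sum_i q i `^ r) * T.
Proof.
move=> r0; apply: chebyshev_sum => i j; apply: powR_opposite => //.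
by rewrite mulNr oppr_le0 divr_ge0.
Qed.

(** The bracket on the right is smallest for z_i^2 = q_i. The sum of
q_i^(p/2) q_i^(- alpha/2) is then at most S T / d by the inequality of
Chebyshev, because the two powers vary in opposite directions. *)
Lemma divergence_ge :
  E * T * (d - 2 - alpha * (d - 1)) / d <=
  \sum_i E * q i `^ (- alpha / 2) *
    (1 - z i ^+ 2 / q i * (alpha + (2 - alpha) * q i `^ (p / 2) / S)).
Proof.
apply: (@le_trans _ _ (\sum_i E * q i `^ (- alpha / 2) *
    (1 - (alpha + (2 - alpha) * q i `^ (p / 2) / S)))); last first.
  apply: ler_sum => i _; rewrite ler_wpM2l ?mulr_ge0 ?powR_ge0// lerB// ler_piMl//.
    apply: addr_ge0 => //; apply: divr_ge0; last exact: ltW.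
    by apply: mulr_ge0; [have := alpha_lt1; lra|exact: powR_ge0].
  by rewrite ler_pdivrMr// mul1r.
have -> : \sum_i E * q i `^ (- alpha / 2) *
    (1 - (alpha + (2 - alpha) * q i `^ (p / 2) / S)) =
  E * ((1 - alpha) * T - (2 - alpha) / S *
    \sum_i q i `^ (p / 2) * q i `^ (- alpha / 2)).
  rewrite mulrBr /T !mulr_sumr -sumrB; apply: eq_bigr => i _; ring.
rewrite -!mulrA; apply: ler_wpM2l; first exact: ltW.
have p2 : 0 <= p / 2 by apply: divr_ge0 => //; exact: ltW.
have := chebT p2.
rewrite -/S; set X := \sum_i _ * _ => h.
have dgt0 : 0 < d by apply: lt_le_trans d3.
have X1 : X / S <= T / d.
  by rewrite ler_pdivrMr// mulrAC ler_pdivlMr// mulrC [T * S]mulrC.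
have -> : T * ((d - 2 - alpha * (d - 1)) / d) =
  (1 - alpha) * T - (2 - alpha) * (T / d).
  by field; rewrite gt_eqF.
rewrite lerB//; apply: ler_wpM2l; first by have := alpha_lt1; lra.
by rewrite mulrC.
Qed.

(** Again by Chebyshev, now for the exponents 1 - alpha/2 and - alpha/2; then the
power sum of exponent 1 - alpha/2 is compared with a power of S. *)
Lemma sqr_norm_le :
  Num.min 1 (d `^ ((2 - p - alpha) / p)) *
    \sum_i (E * q i `^ (- alpha / 2) * z i) ^+ 2 <= E * T / d.
Proof.
have dgt0 : 0 < d by apply: lt_le_trans d3.
set m := Num.min _ _.
have m0 : 0 <= m by rewrite le_min ler01 powR_ge0.
apply: (@le_trans _ _ (m * (E ^+ 2 *
    \sum_i (q i `^ (1 - alpha / 2) * q i `^ (- alpha / 2))))).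
  rewrite ler_wpM2l// mulr_sumr; apply: ler_sum => i _.
  set w := q i `^ (- alpha / 2).
  have -> : q i `^ (1 - alpha / 2) = q i * w.
    rewrite powRD; last by apply/implyP => _; rewrite gt_eqF.
    by rewrite powRr1 ?(ltW (q0 i))// /w mulNr.
  have -> : (E * w * z i) ^+ 2 = (E * w) ^+ 2 * z i ^+ 2 by ring.
  have -> : E ^+ 2 * (q i * w * w) = (E * w) ^+ 2 * q i by ring.
  by apply: ler_wpM2l => //; exact: sqr_ge0.
have h : 0 <= 1 - alpha / 2 by have := alpha_lt1; lra.
have := chebT h; set X := \sum_i _ * _ => XT.
set Y := \sum_i q i `^ (1 - alpha / 2) in XT.
have mY : m * Y <= E^-1.
  have r0 : 0 <= (2 - alpha) / p by rewrite divr_ge0 ?ltW//; have := alpha_lt1; lra.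
  have := min_sum_powR (fun i => powR_gt0 (p / 2) (q0 i)) r0.
  rewrite -/S (_ : (2 - alpha) / p - 1 = (2 - p - alpha) / p); last first.
    by field; rewrite gt_eqF.
  rewrite -/m (_ : \sum_i _ = Y); last first.
    apply: eq_bigr => i _; rewrite -powRrM; congr (_ `^ _).
    by field; rewrite gt_eqF.
  by rewrite -powRN -mulNr opprB.
have XY : X <= Y * T / d by rewrite ler_pdivlMr// mulrC.
apply: (@le_trans _ _ (m * (E ^+ 2 * (Y * T / d)))).
  by rewrite ler_wpM2l// ler_wpM2l// sqr_ge0.
have -> : m * (E ^+ 2 * (Y * T / d)) = (m * Y) * (E ^+ 2 * (T / d)) by ring.
have -> : E * T / d = E^-1 * (E ^+ 2 * (T / d)) by field; rewrite !gt_eqF.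
by rewrite ler_wpM2r// mulr_ge0 ?sqr_ge0// divr_ge0// ltW.
Qed.

(** The upper bound on phi is exactly what combines sqr_norm_le with
divergence_ge. *)
Lemma mul_sqr_norm_le_divergence (phi : R) :
  0 <= phi <= 2 * (n.+1%:R - 2) * gamma n.+1 p alpha ->
  phi * \sum_i (E * q i `^ (- alpha / 2) * z i) ^+ 2 <=
  2 * \sum_i E * q i `^ (- alpha / 2) *
    (1 - z i ^+ 2 / q i * (alpha + (2 - alpha) * q i `^ (p / 2) / S)).
Proof.
move=> /andP[phi0 phi1].
set H := \sum_i _ ^+ 2; have H0 : 0 <= H by apply: sumr_ge0 => i _; exact: sqr_ge0.
apply: le_trans (ler_wpM2l _ divergence_ge) => //.
apply: le_trans (ler_wpM2r H0 phi1) _.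
have -> : 2 * (n.+1%:R - 2) * gamma n.+1 p alpha =
    2 * (d - 2 - alpha * (d - 1)) * Num.min 1 (d `^ ((2 - p - alpha) / p)).
  have d2 : d - 2 != 0 by have := d3; lra.
  rewrite /gamma -/d; field.
  by move: d2; rewrite /d -natr1 [n%:R + 1]addrC.
have -> : 2 * (E * T * (d - 2 - alpha * (d - 1)) / d) =
  2 * (d - 2 - alpha * (d - 1)) * (E * T / d) by ring.
rewrite -[leLHS]mulrA; apply: ler_wpM2l; last exact: sqr_norm_le.
by apply: mulr_ge0 => //; exact: ltW.
Qed.

End q.
End pointwise.

End inequalities.

(** * One coordinate of the smoothed shrinkage field *)

Lemma measurable_inv_gt0 {R : realType} d (T : measurableType d) (f : T -> R) :
  measurable_fun setT f -> (forall t, 0 < f t) ->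
  measurable_fun setT (fun t => (f t)^-1).
Proof.
move=> mf f0; rewrite (_ : (fun _ => _) = (fun t => f t `^ (-1))).
  exact: (measurableT_comp (measurable_powR (-1)) mf).
by apply/funext => t; rewrite powR_inv1// ltW.
Qed.

Section regularised_component.
Context {R : realType}.
Implicit Types x : R.
Variables (p alpha e c : R).
Hypotheses (p0 : 0 < p) (a0 : 0 <= alpha) (a2 : alpha <= 2) (e0 : 0 < e)
  (c0 : 0 <= c).

(** Here x is the coordinate that varies and c is the contribution of the others
to the sum S. Replacing x^2 by x^2 + e removes the singularities of the field
and makes its derivative bounded. *)
Definition reg_sq (x : R) := x ^+ 2 + e.
Definition reg_sum (x : R) := reg_sq x `^ (p / 2) + c.
Definition reg_comp (x : R) :=
  reg_sum x `^ ((alpha - 2) / p) * reg_sq x `^ (- alpha / 2) * x.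
Definition reg_comp' (x : R) :=
  reg_sum x `^ ((alpha - 2) / p) * reg_sq x `^ (- alpha / 2) *
  (1 - x ^+ 2 / reg_sq x * (alpha + (2 - alpha) * reg_sq x `^ (p / 2) / reg_sum x)).

Lemma reg_sq_gt0 x : 0 < reg_sq x.
Proof. by rewrite ltr_wpDl// sqr_ge0. Qed.

Lemma reg_sum_gt0 x : 0 < reg_sum x.
Proof. by rewrite ltr_pwDl// powR_gt0// reg_sq_gt0. Qed.

Lemma is_derive_reg_comp x : is_derive x 1 reg_comp (reg_comp' x).
Proof.
have q0 := reg_sq_gt0 x; have S0 := reg_sum_gt0 x.
have dq : is_derive x 1 reg_sq (2 * x).
  by rewrite /reg_sq; apply: is_derive_eq; rewrite /GRing.scale/=; ring.
have dqp r : is_derive x 1 (fun y => reg_sq y `^ r) (r * reg_sq x `^ (r - 1) * (2 * x)).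
  exact: (is_derive1_comp (is_derive1_powR r q0) dq).
have dS : is_derive x 1 reg_sum (p / 2 * reg_sq x `^ (p / 2 - 1) * (2 * x)).
  have ? := dqp (p / 2).
  by rewrite /reg_sum; apply: is_derive_eq; rewrite addr0.
have dSb r : is_derive x 1 (fun y => reg_sum y `^ r)
    (r * reg_sum x `^ (r - 1) * (p / 2 * reg_sq x `^ (p / 2 - 1) * (2 * x))).
  exact: (is_derive1_comp (is_derive1_powR r S0) dS).
have powB (y r : R) : 0 < y -> y `^ (r - 1) = y `^ r / y.
  move=> y0; rewrite powRB; last by apply/implyP => _; rewrite gt_eqF.
  by rewrite powRr1// ltW.
have ? := dSb ((alpha - 2) / p); have ? := dqp (- alpha / 2).
rewrite /reg_comp; apply: is_derive_eq.
rewrite /reg_comp' /GRing.scale/= !powB//; field.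
by rewrite !gt_eqF.
Qed.

(** It does not depend on c: bounds along one coordinate have to be uniform in
the others. *)
Definition reg_bound := (e `^ (p / 2)) `^ ((alpha - 2) / p) * e `^ (- alpha / 2).

Lemma reg_bound_ge0 : 0 <= reg_bound.
Proof. by rewrite mulr_ge0 ?powR_ge0. Qed.

Lemma reg_factor_le x :
  0 <= reg_sum x `^ ((alpha - 2) / p) * reg_sq x `^ (- alpha / 2) <= reg_bound.
Proof.
have eq : e <= reg_sq x by rewrite lerDr sqr_ge0.
rewrite mulr_ge0 ?powR_ge0//= ler_pM ?powR_ge0//.
- apply: powR_le_neg; rewrite ?powR_gt0//.
    by apply: mulr_le0_ge0; [rewrite subr_le0|rewrite invr_ge0 ltW].
  apply: le_trans (_ : reg_sq x `^ (p / 2) <= _); last by rewrite lerDl.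
  apply: ge0_ler_powR => //; rewrite ?nnegrE ?ltW ?reg_sq_gt0//.
  by rewrite divr_gt0.
- by apply: powR_le_neg; rewrite // mulNr oppr_le0 divr_ge0.
Qed.

Lemma reg_comp_le x : `|reg_comp x| <= reg_bound * `|x|.
Proof.
have /andP[h0 h1] := reg_factor_le x.
by rewrite /reg_comp normrM (ger0_norm h0) ler_wpM2r.
Qed.

Lemma reg_comp'_le x : `|reg_comp' x| <= reg_bound.
Proof.
have /andP[h0 h1] := reg_factor_le x.
rewrite /reg_comp' normrM (ger0_norm h0) -[leRHS]mulr1 ler_pM//.
have q0 := reg_sq_gt0 x; have S0 := reg_sum_gt0 x.
have t0 : 0 <= x ^+ 2 / reg_sq x by rewrite divr_ge0 ?sqr_ge0// ltW.
have t1 : x ^+ 2 / reg_sq x <= 1 by rewrite ler_pdivrMr// mul1r lerDl ltW.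
have u0 : 0 <= reg_sq x `^ (p / 2) / reg_sum x by rewrite divr_ge0 ?powR_ge0// ltW.
have u1 : reg_sq x `^ (p / 2) / reg_sum x <= 1 by rewrite ler_pdivrMr// mul1r lerDl.
rewrite -(mulrA (2 - alpha)).
move: (_ / reg_sq x) (_ / reg_sum x) t0 t1 u0 u1 => t u t0 t1 u0 u1.
have v0 : 0 <= alpha + (2 - alpha) * u by rewrite addr_ge0// mulr_ge0// subr_ge0.
have v2 : alpha + (2 - alpha) * u <= 2.
  by have : (2 - alpha) * (1 - u) >= 0 by [rewrite mulr_ge0// subr_ge0]; nra.
move: (_ + _ * u) v0 v2 => v v0 v2.
have tv0 : 0 <= t * v by exact: mulr_ge0.
have tv2 : t * v <= 1 * 2 by exact: ler_pM.
by rewrite ler_norml; apply/andP; split; lra.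
Qed.

Lemma reg_comp_sign x : (0 <= x -> 0 <= reg_comp x) /\ (x <= 0 -> reg_comp x <= 0).
Proof.
have /andP[h0 _] := reg_factor_le x.
by split=> ?; [exact: mulr_ge0|exact: mulr_ge0_le0].
Qed.

Lemma measurable_reg_sq : measurable_fun setT reg_sq.
Proof. by apply: measurable_funD => //; exact: measurable_funX. Qed.

Lemma measurable_reg_sum : measurable_fun setT reg_sum.
Proof.
apply: measurable_funD => //.
exact: (measurableT_comp (measurable_powR _) measurable_reg_sq).
Qed.

Lemma measurable_reg_comp' : measurable_fun setT reg_comp'.
Proof.
have mS r := measurableT_comp (measurable_powR r) measurable_reg_sum.
have mq r := measurableT_comp (measurable_powR r) measurable_reg_sq.
apply: measurable_funM; first by apply: measurable_funM; [exact: mS|exact: mq].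
apply: measurable_funB => //; apply: measurable_funM.
  apply: measurable_funM; first exact: measurable_funX.
  by apply: measurable_inv_gt0; [exact: measurable_reg_sq|exact: reg_sq_gt0].
apply: measurable_funD => //; apply: measurable_funM.
  by apply: measurable_funM => //; exact: mq.
by apply: measurable_inv_gt0; [exact: measurable_reg_sum|exact: reg_sum_gt0].
Qed.

End regularised_component.

(** * Risk of the smoothed estimator, and the limit *)

Section regularised_risk.
Context {R : realType}.
Variables (n : nat) (s p alpha : R) (phi : R -> R) (theta : n.+1.-tuple R).
Hypotheses (s0 : 0 < s) (p0 : 0 < p) (n3 : (3 <= n.+1)%N) (a0 : 0 <= alpha)
  (a1 : alpha < (n.+1%:R - 2) / (n.+1%:R - 1))
  (phi_nd : forall u v : R, 0 <= u -> u <= v -> phi u <= phi v)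
  (phi_bd : forall v : R, 0 <= v ->
       0 <= phi v <= 2 * (n.+1%:R - 2) * gamma n.+1 p alpha).

Let M := 2 * (n.+1%:R - 2) * gamma n.+1 p alpha.
Implicit Types (z : n.+1.-tuple R) (x : R).

Lemma alpha_le2 : alpha <= 2.
Proof.
have n1 : 0 < n.+1%:R - 1 :> R by rewrite subr_gt0 ltr1n (leq_trans _ n3).
apply: (le_trans (ltW a1)); rewrite ler_pdivrMr//.
by have : 1 < n.+1%:R :> R by [rewrite ltr1n (leq_trans _ n3)]; lra.
Qed.

Definition phi_norm z := phi (pnorm p z / s).

Lemma pnorm_ge0 z : 0 <= pnorm p z. Proof. exact: powR_ge0. Qed.

Lemma phi_norm_bounds z : 0 <= phi_norm z <= M.
Proof. by apply: phi_bd; rewrite divr_ge0 ?pnorm_ge0// ltW. Qed.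

Lemma measurable_pnorm : measurable_fun setT (@pnorm R n.+1 p).
Proof.
apply: (measurableT_comp (measurable_powR p^-1)).
apply: measurable_sum => i; apply: (measurableT_comp (measurable_powR p)).
exact: (measurableT_comp (@normr_measurable _ _) (measurable_tnth i)).
Qed.

Lemma measurable_phi_norm : measurable_fun setT phi_norm.
Proof.
pose g v := phi (Num.max 0 v).
have mg : measurable_fun setT g.
  apply: nondecreasing_measurable => // u v uv; rewrite /g phi_nd//.
    by rewrite le_max lexx.
  by rewrite ge_max !le_max lexx uv orbT.
rewrite (_ : phi_norm = g \o (fun z => pnorm p z / s)).
  apply: (measurableT_comp mg); apply: measurable_funM => //.
  exact: measurable_pnorm.
apply/funext => z; rewrite /phi_norm /g/= max_r//.
by rewrite divr_ge0 ?pnorm_ge0// ltW.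
Qed.

Lemma pnorm_set_coord_le z i x y : `|x| <= `|y| ->
  pnorm p (set_coord z i x) <= pnorm p (set_coord z i y).
Proof.
move=> xy; apply: ge0_ler_powR; rewrite ?nnegrE ?invr_ge0 ?(ltW p0)//.
- by apply: sumr_ge0 => j _; exact: powR_ge0.
- by apply: sumr_ge0 => j _; exact: powR_ge0.
apply: ler_sum => j _; rewrite !tnth_set_coord; case: (j == i) => //.
by apply: ge0_ler_powR; rewrite ?nnegrE ?(ltW p0).
Qed.

(** This monotonicity in the modulus of each coordinate is what stein_inequality
asks of the weight. *)
Lemma phi_norm_set_coord_le z i x y : `|x| <= `|y| ->
  phi_norm (set_coord z i x) <= phi_norm (set_coord z i y).
Proof.
move=> xy; apply: phi_nd; first by rewrite divr_ge0 ?pnorm_ge0// ltW.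
apply: ler_wpM2r; last exact: pnorm_set_coord_le.
by rewrite invr_ge0 ltW.
Qed.

Section fixed_e.
Variable e : R.
Hypothesis e0 : 0 < e.

(** reg_field i is the i-th component of the smoothed field and reg_dfield i its
partial derivative in coordinate i; they are written through other_sum so that
the results on one coordinate apply after set_coord. *)
Definition other_sum z i := \sum_(j < n.+1 | j != i) reg_sq e (tnth z j) `^ (p / 2).
Definition reg_field i z := reg_comp p alpha e (other_sum z i) (tnth z i).
Definition reg_dfield i z := reg_comp' p alpha e (other_sum z i) (tnth z i).

Lemma other_sum_ge0 z i : 0 <= other_sum z i.
Proof. by apply: sumr_ge0 => j _; exact: powR_ge0. Qed.

Lemma other_sum_set_coord z i x : other_sum (set_coord z i x) i = other_sum z i.
Proof. by apply: eq_bigr => j /negbTE ji; rewrite tnth_set_coord ji. Qed.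

Lemma reg_sum_other_sum z i : reg_sum p e (other_sum z i) (tnth z i) =
  \sum_j reg_sq e (tnth z j) `^ (p / 2).
Proof. by rewrite (bigD1 i). Qed.

Lemma reg_field_set_coord z i x :
  reg_field i (set_coord z i x) = reg_comp p alpha e (other_sum z i) x.
Proof. by rewrite /reg_field other_sum_set_coord tnth_set_coord eqxx. Qed.

Lemma reg_dfield_set_coord z i x :
  reg_dfield i (set_coord z i x) = reg_comp' p alpha e (other_sum z i) x.
Proof. by rewrite /reg_dfield other_sum_set_coord tnth_set_coord eqxx. Qed.

(** The i-th square error, plus twice the integrand of stein_inequality for
coordinate i: the risk estimate of Stein with its first-order terms kept. *)
Definition sure_term i z := (tnth z i - tnth theta i) ^+ 2 / s ^+ 2 +
  2 * (phi_norm z * (s ^+ 2 * reg_dfield i z - (tnth z i - tnth theta i) * reg_field i z)).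

(** Only the direction is smoothed; phi keeps the p-norm of z as its argument. *)
Definition reg_shrinkage z : n.+1.-tuple R :=
  [tuple tnth z i - s ^+ 2 * phi_norm z * reg_field i z | i < n.+1].

(** After expansion of the square the difference is s^2 phi times
2 div h - phi |h|^2 for the smoothed field h. *)
Lemma loss_reg_shrinkage_le z : loss s (reg_shrinkage z) theta <= \sum_i sure_term i z.
Proof.
have h := @mul_sqr_norm_le_divergence R n p alpha p0 n3 a0 a1
  (fun i => reg_sq e (tnth z i)) (tnth z) (fun i => reg_sq_gt0 e0 _)
  (fun i => ltac:(by rewrite lerDl ltW)) _ (phi_norm_bounds z).
have {}h : phi_norm z * \sum_i reg_field i z ^+ 2 <= 2 * \sum_i reg_dfield i z.
  move: h; congr (_ * _ <= _ * _); apply: eq_bigr => i _.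
    by rewrite /reg_field /reg_comp reg_sum_other_sum.
  by rewrite /reg_dfield /reg_comp' reg_sum_other_sum.
have /andP[phi0 _] := phi_norm_bounds z.
have sn0 : s != 0 by rewrite gt_eqF.
rewrite /loss -subr_ge0 -sumrB.
have -> : \sum_(i < n.+1) (sure_term i z - (tnth (reg_shrinkage z) i - tnth theta i) ^+ 2 / s ^+ 2)
   = s ^+ 2 * phi_norm z * (2 * \sum_i reg_dfield i z - phi_norm z * \sum_i reg_field i z ^+ 2).
  rewrite mulrBr !mulr_sumr -sumrB; apply: eq_bigr => i _.
  by rewrite tnth_mktuple /sure_term; field.
by rewrite mulr_ge0 ?subr_ge0// mulr_ge0// sqr_ge0.
Qed.

Let measurable_coord_reg_sq i :
  measurable_fun [set: n.+1.-tuple R] (fun z => reg_sq e (tnth z i)).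
Proof. exact: (measurableT_comp (measurable_reg_sq e) (measurable_tnth i)). Qed.

Let measurable_total : measurable_fun [set: n.+1.-tuple R]
  (fun z => \sum_j reg_sq e (tnth z j) `^ (p / 2)).
Proof.
apply: measurable_sum => j.
exact: (measurableT_comp (measurable_powR _) (measurable_coord_reg_sq j)).
Qed.

Let measurable_factor i : measurable_fun [set: n.+1.-tuple R]
  (fun z => (\sum_j reg_sq e (tnth z j) `^ (p / 2)) `^ ((alpha - 2) / p) *
    reg_sq e (tnth z i) `^ (- alpha / 2)).
Proof.
apply: measurable_funM.
  exact: (measurableT_comp (measurable_powR _) measurable_total).
exact: (measurableT_comp (measurable_powR _) (measurable_coord_reg_sq i)).
Qed.

Lemma measurable_reg_field i : measurable_fun setT (reg_field i).
Proof.
rewrite (_ : reg_field i = fun z => (\sum_j reg_sq e (tnth z j) `^ (p / 2)) `^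
    ((alpha - 2) / p) * reg_sq e (tnth z i) `^ (- alpha / 2) * tnth z i).
  by apply: measurable_funM; [exact: measurable_factor|exact: measurable_tnth].
by apply/funext => z; rewrite /reg_field /reg_comp reg_sum_other_sum.
Qed.

Lemma measurable_reg_dfield i : measurable_fun setT (reg_dfield i).
Proof.
rewrite (_ : reg_dfield i = fun z => (\sum_j reg_sq e (tnth z j) `^ (p / 2)) `^
    ((alpha - 2) / p) * reg_sq e (tnth z i) `^ (- alpha / 2) *
    (1 - tnth z i ^+ 2 / reg_sq e (tnth z i) * (alpha + (2 - alpha) *
      reg_sq e (tnth z i) `^ (p / 2) / \sum_j reg_sq e (tnth z j) `^ (p / 2)))).
  apply: measurable_funM; first exact: measurable_factor.
  apply: measurable_funB => //; apply: measurable_funM.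
    apply: measurable_funM; first by apply: measurable_funX; exact: measurable_tnth.
    by apply: measurable_inv_gt0 => // z; exact: reg_sq_gt0.
  apply: measurable_funD => //; apply: measurable_funM.
    apply: measurable_funM => //.
    exact: (measurableT_comp (measurable_powR _) (measurable_coord_reg_sq i)).
  apply: measurable_inv_gt0 => // z.
  by rewrite -(reg_sum_other_sum z ord0); apply: reg_sum_gt0 => //; exact: other_sum_ge0.
by apply/funext => z; rewrite /reg_dfield /reg_comp' reg_sum_other_sum.
Qed.

Lemma measurable_sure_term i : measurable_fun setT (sure_term i).
Proof.
have mz : measurable_fun [set: n.+1.-tuple R] (fun z => tnth z i - tnth theta i).
  by apply: measurable_funB => //; exact: measurable_tnth.
apply: measurable_funD.
  by apply: measurable_funM => //; exact: measurable_funX.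
apply: measurable_funM => //; apply: measurable_funM; first exact: measurable_phi_norm.
apply: measurable_funB.
  by apply: measurable_funM => //; exact: measurable_reg_dfield.
by apply: measurable_funM => //; exact: measurable_reg_field.
Qed.

Lemma measurable_reg_shrinkage : measurable_fun setT reg_shrinkage.
Proof.
apply/measurable_fun_tnthP => i.
rewrite (_ : _ \o _ = fun z => tnth z i - s ^+ 2 * phi_norm z * reg_field i z).
  apply: measurable_funB; first exact: measurable_tnth.
  apply: measurable_funM; last exact: measurable_reg_field.
  by apply: measurable_funM => //; exact: measurable_phi_norm.
by apply/funext => z /=; rewrite tnth_mktuple.
Qed.

(** In coordinate i, with the others frozen, the square error contributes at most
1 and the integrand of stein_inequality at most 0. Here K0 + K1 (x - m)^2
bounds the term uniformly in the frozen coordinates. *)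
Lemma integral_sure_term_le1 i :
  (normal_vector s theta).-integrable setT (EFin \o sure_term i) /\
  (\int[normal_vector s theta]_z (sure_term i z)%:E <= 1)%E.
Proof.
have M0 : 0 <= M by have /andP[] := phi_norm_bounds (tuple_zero n.+1); apply: le_trans.
have sn0 : s != 0 by rewrite gt_eqF.
have s2 : 0 < s ^+ 2 by rewrite exprn_gt0.
set m := tnth theta i; pose N := normal_prob m s.
pose C := reg_bound p alpha e.
have C0 : 0 <= C by exact: reg_bound_ge0.
have [idev ledev] := normal_sqr_dev_le m sn0.
pose K0 := 2 * M * C * (s ^+ 2 + `|m|).
pose K1 := 1 / s ^+ 2 + 2 * M * C * (1 + `|m|).
have K00 : 0 <= K0.
  by rewrite /K0; apply: mulr_ge0; [apply: mulr_ge0 => //; exact: mulr_ge0|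
    apply: addr_ge0 => //; exact: ltW].
have K10 : 0 <= K1.
  rewrite /K1; apply: addr_ge0; first by apply: divr_ge0 => //; exact: ltW.
  by apply: mulr_ge0; [apply: mulr_ge0 => //; exact: mulr_ge0|exact: addr_ge0].
have mset z : measurable_fun setT (set_coord z i).
  exact: (@measurable_set_coord _ _ R _ (cst z) i id).
apply: (@integral_le_coord _ _ _ _ i _ (K0 + K1 * s ^+ 2)) => //.
- exact: measurable_sure_term.
- move=> z; rewrite -/m -/N.
  have mK : measurable_fun setT (fun x : measurableTypeR R =>
      (K1%:E * ((x - m) ^+ 2)%:E)%E).
    by have /integrableP[] := integrableZl measurableT K1 idev.
  have bnd x : `|sure_term i (set_coord z i x)| <= K0 + K1 * (x - m) ^+ 2.
    rewrite /sure_term reg_field_set_coord reg_dfield_set_coord tnth_set_coord eqxx -/m.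
    have /andP[P0 PM] := phi_norm_bounds (set_coord z i x).
    have D1 := reg_comp'_le p0 a0 alpha_le2 e0 (other_sum_ge0 z i) x.
    have H1 := reg_comp_le p0 a0 alpha_le2 e0 (other_sum_ge0 z i) x.
    move: (reg_comp' _ _ _ _ x) (reg_comp _ _ _ _ x) D1 H1 => D H; rewrite -/C => D1 H1.
    apply: le_trans (ler_normD _ _) _.
    rewrite (ger0_norm (_ : 0 <= (x - m) ^+ 2 / s ^+ 2)); last first.
      by apply: divr_ge0; exact: sqr_ge0.
    have xu : `|x| <= `|x - m| + `|m| by rewrite -{1}(subrK m x) ler_normD.
    have H2 : `|H| <= C * (`|x - m| + `|m|).
      by apply: le_trans H1 _; exact: ler_wpM2l.
    have SD : `|s ^+ 2 * D - (x - m) * H| <=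
        s ^+ 2 * C + `|x - m| * (C * (`|x - m| + `|m|)).
      apply: le_trans (ler_normB _ _) _.
      rewrite [`|s ^+ 2 * D|]normrM (ger0_norm (ltW s2)) normrM.
      by apply: lerD; apply: ler_wpM2l => //; exact: ltW.
    rewrite !normrM (ger0_norm P0) ger0_norm//.
    apply: (@le_trans _ _ ((x - m) ^+ 2 / s ^+ 2 +
        2 * (M * (s ^+ 2 * C + `|x - m| * (C * (`|x - m| + `|m|)))))).
      by rewrite lerD2l; apply: ler_wpM2l => //; exact: ler_pM.
    rewrite -subr_ge0 -(real_normK (num_real (x - m))).
    move: `|x - m| (normr_ge0 (x - m)) => u u0.
    rewrite (_ : _ - _ = 2 * M * C * `|m| * (1 + u ^+ 2 - u)); last first.
      by rewrite /K0 /K1; ring.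
    apply: mulr_ge0; last nra.
    by apply: mulr_ge0 => //; apply: mulr_ge0 => //; exact: mulr_ge0.
  apply: (@le_trans _ _ (\int[N]_x (K0%:E + K1%:E * ((x - m) ^+ 2)%:E))%E).
    apply: ge0_le_integral => //.
    + apply/measurable_EFinP; apply: measurableT_comp => //.
      by apply: measurableT_comp (mset z); exact: measurable_sure_term.
    + by apply: emeasurable_funD => //; exact: mK.
    + by move=> x _; rewrite -EFinM -EFinD lee_fin.
  rewrite ge0_integralD//; last first.
    by move=> x _; rewrite -EFinM lee_fin mulr_ge0// sqr_ge0.
  clearbody K0 K1; rewrite integral_normal_prob_cst integralZl// EFinD EFinM.
  by apply: leeD2l; apply: lee_wpmul2l => //; rewrite lee_fin.
- move=> z; rewrite -/m -/N.
  pose P x := phi_norm (set_coord z i x).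
  have [] := @stein_inequality R m s (reg_comp p alpha e (other_sum z i))
    (reg_comp' p alpha e (other_sum z i)) P (C * (1 + `|m|)) M sn0.
  + by move=> x; apply: is_derive_reg_comp => //; exact: other_sum_ge0.
  + by apply: measurable_reg_comp' => //; exact: other_sum_ge0.
  + by apply: measurableT_comp (mset z); exact: measurable_phi_norm.
  + move=> x; apply: le_trans (reg_comp_le p0 a0 alpha_le2 e0 (other_sum_ge0 z i) x) _.
    rewrite -/C -mulrA; apply: ler_wpM2l => //.
    have xu : `|x| <= `|x - m| + `|m| by rewrite -{1}(subrK m x) ler_normD.
    apply: le_trans xu _.
    by have := normr_ge0 m; have := normr_ge0 (x - m); nra.
  + move=> x; apply: le_trans (reg_comp'_le p0 a0 alpha_le2 e0 (other_sum_ge0 z i) x) _.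
    by rewrite -/C ler_peMr// lerDl.
  + move=> x; have /andP[h1 h2] := phi_norm_bounds (set_coord z i x).
    by rewrite ger0_norm.
  + move=> u x u0.
    have [pos neg] := reg_comp_sign p0 a0 alpha_le2 e0 (other_sum_ge0 z i) x.
    have [x0|/ltW x0] := leP 0 x.
      apply: mulr_le0_ge0; last exact: pos.
      rewrite subr_le0; apply: phi_norm_set_coord_le.
      rewrite [leRHS]ger0_norm; last by lra.
      by rewrite ler_norml; apply/andP; split; lra.
    apply: mulr_ge0_le0; last exact: neg.
    rewrite subr_ge0; apply: phi_norm_set_coord_le.
    rewrite [leRHS]ler0_norm; last by lra.
    by rewrite ler_norml; apply/andP; split; lra.
  set G := (fun x => _) => iG leG.
  have E : (fun x => (sure_term i (set_coord z i x))%:E) =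
    ((fun x => (s ^+ 2)^-1%:E * ((x - m) ^+ 2)%:E) \+ (fun x => 2%:E * G x))%E.
    apply/funext => x /=; rewrite /sure_term /G /P reg_field_set_coord.
    rewrite reg_dfield_set_coord tnth_set_coord eqxx.
    by rewrite -!EFinM -EFinD mulrC.
  have i1 := integrableZl measurableT (s ^+ 2)^-1 idev.
  have i2 := integrableZl measurableT 2 iG.
  rewrite (_ : (\int[N]_x _)%E =
    (\int[N]_x ((fun x => (s ^+ 2)^-1%:E * ((x - m) ^+ 2)%:E) \+
      (fun x => 2%:E * G x)) x)%E); last by rewrite -E.
  rewrite integralD// !integralZl//.
  rewrite -[leRHS]adde0; apply: leeD; last by apply: mule_ge0_le0.
  apply: (@le_trans _ _ ((s ^+ 2)^-1%:E * (s ^+ 2)%:E)%E).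
    by apply: lee_wpmul2l => //; rewrite lee_fin invr_ge0 ltW.
  by rewrite -EFinM mulVf// gt_eqF.
Qed.

Lemma risk_reg_shrinkage_le : (risk s reg_shrinkage theta <= n.+1%:R%:E)%E.
Proof.
rewrite /risk unlock.
have lossm : measurable_fun setT (fun z => loss s (reg_shrinkage z) theta).
  apply: measurable_sum => i; apply: measurable_funM => //.
  apply: measurable_funX; apply: measurable_funB => //.
  exact: (measurableT_comp (measurable_tnth i) measurable_reg_shrinkage).
have loss0 z : 0 <= loss s (reg_shrinkage z) theta.
  by apply: sumr_ge0 => i _; rewrite divr_ge0 ?sqr_ge0.
apply: (@le_trans _ _ (\int[normal_vector s theta]_z (\sum_i (EFin \o sure_term i) z))%E).
  apply: ge0_le_integral => //.
  - by move=> z _; rewrite lee_fin.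
  - exact/measurable_EFinP.
  - by apply: emeasurable_sum => i; apply/measurable_EFinP; exact: measurable_sure_term.
  - by move=> z _; rewrite sumEFin lee_fin; exact: loss_reg_shrinkage_le.
rewrite integral_sum//; last by move=> i; exact: (integral_sure_term_le1 i).1.
apply: (@le_trans _ _ (\sum_(i < n.+1) 1)%E).
  by apply: lee_sum => i _; exact: (integral_sure_term_le1 i).2.
by rewrite sumEFin sumr_const card_ord.
Qed.

End fixed_e.
End regularised_risk.

Section limit.
Context {R : realType}.

Lemma cvg_powR_gt0 (u : R^nat) (l r : R) : 0 < l -> u @ \oo --> l ->
  u k `^ r @[k --> \oo] --> l `^ r.
Proof.
move=> l0 ul.
have c : {for l, continuous (fun x : R => x `^ r)}.
  apply: differentiable_continuous; apply/derivable1_diffP.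
  by have [] := is_derive1_powR r l0.
exact: (cvg_comp u (fun x : R => x `^ r) ul c).
Qed.

Lemma cvg_sumr (I : Type) (t : seq I) (f : I -> R^nat) (l : I -> R) :
  (forall i, f i @ \oo --> l i) ->
  \sum_(i <- t) f i k @[k --> \oo] --> \sum_(i <- t) l i.
Proof.
move=> fl; elim: t => [|i t IH].
  by rewrite big_nil; under eq_fun do rewrite big_nil; exact: cvg_cst.
by rewrite big_cons; under eq_fun do rewrite big_cons; exact: cvgD.
Qed.

(** The limit may be 0: coordinates of z are allowed to vanish. *)
Lemma cvg_powR (u : R^nat) (l r : R) : 0 < r -> 0 <= l -> (forall k, 0 < u k) ->
  u @ \oo --> l -> u k `^ r @[k --> \oo] --> l `^ r.
Proof.
move=> r0; rewrite le_eqVlt => /predU1P[<-|l0] u0 ul; last exact: cvg_powR_gt0.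
rewrite powR0 ?gt_eqF//.
by have /cvg_at_rightP := powR_cvg0 r0; apply.
Qed.

Variables (n : nat) (s p alpha : R) (phi : R -> R).
Hypotheses (s0 : 0 < s) (p0 : 0 < p).
Implicit Types (z : n.+1.-tuple R).

Let eps k : R := harmonic k.
Let eps_gt0 k : 0 < eps k. Proof. by rewrite invr_gt0. Qed.

Lemma cvg_reg_sq (x : R) : reg_sq (eps k) x @[k --> \oo] --> x ^+ 2.
Proof.
rewrite -[X in _ --> X]addr0; apply: cvgD; first exact: cvg_cst.
exact: cvg_harmonic.
Qed.

Lemma sqr_powR (x r : R) : (x ^+ 2) `^ (r / 2) = `|x| `^ r.
Proof.
rewrite -(real_normK (num_real x)) -powR_mulrn// -powRrM; congr (_ `^ _).
by field.
Qed.

(** When the i-th coordinate vanishes both sides are 0 because of the factor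
tnth z i, whatever the convention for the singular factor. *)
Lemma cvg_reg_field i z : reg_field p alpha (eps k) i z @[k --> \oo] -->
  tnth z i / (pnorm p z `^ (2 - alpha) * `|tnth z i| `^ alpha).
Proof.
have [zi0|zi0] := eqVneq (tnth z i) 0.
  rewrite zi0 mul0r (_ : (fun k => _) = cst 0); first exact: cvg_cst.
  by apply/funext => k; rewrite /reg_field /reg_comp zi0 mulr0.
pose S := \sum_j `|tnth z j| `^ p.
have S0 : 0 < S.
  rewrite /S (bigD1 i)//= ltr_wpDr ?powR_gt0 ?normr_gt0//.
  by apply: sumr_ge0 => j _; exact: powR_ge0.
have cS : \sum_j reg_sq (eps k) (tnth z j) `^ (p / 2) @[k --> \oo] --> S.
  apply: cvg_sumr => j; rewrite -sqr_powR; apply: cvg_powR.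
  - by rewrite divr_gt0.
  - exact: sqr_ge0.
  - by move=> k; exact: reg_sq_gt0.
  - exact: cvg_reg_sq.
have -> : tnth z i / (pnorm p z `^ (2 - alpha) * `|tnth z i| `^ alpha) =
    S `^ ((alpha - 2) / p) * (tnth z i ^+ 2) `^ (- alpha / 2) * tnth z i.
  rewrite sqr_powR powRN invfM mulrC; congr (_ * _ * _).
  rewrite /pnorm -/S -powRrM -powRN; congr (_ `^ _).
  by field; rewrite gt_eqF.
rewrite (_ : (fun k => _) = (fun k =>
  (\sum_j reg_sq (eps k) (tnth z j) `^ (p / 2)) `^ ((alpha - 2) / p) *
  reg_sq (eps k) (tnth z i) `^ (- alpha / 2) * tnth z i)); last first.
  by apply/funext => k; rewrite /reg_field /reg_comp reg_sum_other_sum.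
apply: cvgM; last exact: cvg_cst.
apply: cvgM; first exact: cvg_powR_gt0.
apply: cvg_powR_gt0; last exact: cvg_reg_sq.
by rewrite exprn_even_gt0.
Qed.

Lemma cvg_reg_shrinkage i z :
  tnth (reg_shrinkage s p alpha phi (eps k) z) i @[k --> \oo] -->
  tnth (shrinkage s p alpha phi z) i.
Proof.
rewrite (_ : tnth (shrinkage s p alpha phi z) i = tnth z i -
  s ^+ 2 * phi_norm s p phi z *
    (tnth z i / (pnorm p z `^ (2 - alpha) * `|tnth z i| `^ alpha))); last first.
  by rewrite tnth_mktuple /phi_norm; ring.
under eq_fun do rewrite tnth_mktuple.
apply: cvgB; first exact: cvg_cst.
by apply: cvgM; [exact: cvg_cst|exact: cvg_reg_field].
Qed.

Hypotheses (n3 : (3 <= n.+1)%N) (a0 : 0 <= alpha)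
  (a1 : alpha < (n.+1%:R - 2) / (n.+1%:R - 1))
  (phi_nd : forall u v : R, 0 <= u -> u <= v -> phi u <= phi v)
  (phi_bd : forall v : R, 0 <= v ->
       0 <= phi v <= 2 * (n.+1%:R - 2) * gamma n.+1 p alpha).

Let mreg k : measurable_fun [set: n.+1.-tuple R]
  (reg_shrinkage s p alpha phi (eps k)).
Proof. by apply: measurable_reg_shrinkage => //; exact: eps_gt0. Qed.

Lemma measurable_shrinkage :
  measurable_fun [set: n.+1.-tuple R] (shrinkage s p alpha phi).
Proof.
apply/measurable_fun_tnthP => i.
apply: (@measurable_fun_cvg _ _ _ _
  (fun k z => tnth (reg_shrinkage s p alpha phi (eps k) z) i)).
- by move=> k; have /measurable_fun_tnthP := mreg k; exact.
- by move=> z _; exact: cvg_reg_shrinkage.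
Qed.

(** By Fatou, since the losses of the smoothed estimators converge everywhere. *)
Lemma risk_shrinkage_le (theta : n.+1.-tuple R) :
  (risk s (shrinkage s p alpha phi) theta <= n.+1%:R%:E)%E.
Proof.
rewrite /risk unlock.
pose f k z := (loss s (reg_shrinkage s p alpha phi (eps k) z) theta)%:E.
have lim z : f ^~ z @ \oo --> (loss s (shrinkage s p alpha phi z) theta)%:E.
  apply: cvg_EFin; first by apply: nearW.
  apply: cvg_sumr => i; apply: cvgM; last exact: cvg_cst.
  rewrite expr2; under eq_fun do rewrite expr2.
  by apply: cvgM; apply: cvgB; (exact: cvg_cst || exact: cvg_reg_shrinkage).
have mf k : measurable_fun setT (f k).
  apply/measurable_EFinP; apply: measurable_sum => i; apply: measurable_funM => //.
  apply: measurable_funX; apply: measurable_funB => //.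
  exact: (measurableT_comp (measurable_tnth i) (mreg k)).
have f0 k z : [set: n.+1.-tuple R] z -> (0 <= f k z)%E.
  by move=> _; rewrite lee_fin; apply: sumr_ge0 => i _; rewrite divr_ge0 ?sqr_ge0.
have fat := @fatou _ _ _ (normal_vector s theta) setT measurableT f mf f0.
apply: le_trans (le_trans _ fat) _.
  rewrite le_eqVlt; apply/orP; left; apply/eqP; apply: eq_integral => z _.
  by rewrite (cvg_limn_einf_sup (lim z)).1.
rewrite limn_einf_lim; apply: lime_le; first exact: is_cvg_einfs.
apply: nearW => k; apply: (@le_trans _ _ (\int[normal_vector s theta]_z f k z)%E).
  by apply: ereal_inf_lbound; exists k => //=.
have := risk_reg_shrinkage_le theta s0 p0 n3 a0 a1 phi_nd phi_bd (eps_gt0 k).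
by rewrite /risk unlock.
Qed.

End limit.

Theorem theorem2p1 (R : realType) (d : nat) (sigma p alpha : R) (phi : R -> R)
    (sigma_gt0 : 0 < sigma) (p_gt0 : 0 < p)
    (d_ge3 : (3 <= d)%N)
    (alpha_ge0 : 0 <= alpha) (alpha_lt : alpha < (d%:R - 2) / (d%:R - 1))
    (phi_ac : abs_continuous_on `[0, +oo[ phi)
    (phi_nondecreasing : forall u v : R, 0 <= u -> u <= v -> phi u <= phi v)
    (phi_bounds : forall v : R, 0 <= v ->
       0 <= phi v <= 2 * (d%:R - 2) * gamma d p alpha) :
  minimax sigma (shrinkage (d := d) sigma p alpha phi).
Proof.
case: d d_ge3 alpha_lt phi_bounds => // n n3 a1 phi_bd.
split; first exact: measurable_shrinkage.
move=> delta' md'; apply: le_trans (sup_risk_ge sigma_gt0 md').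
by apply: ge_ereal_sup => _ [theta _ <-]; exact: risk_shrinkage_le.
Qed.
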